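(* Let $n\ge 1$ and $k\in\{0,1,\dots,n-1\}$. Let $V$ and $V'$ be $2n$-dimensional vector spaces over fields $F$ and $F'$, with non-degenerate symplectic forms $\Omega$ on $V$ and $\Omega'$ on $V'$, and let $\Pi=(P,\mathcal L)$, $\Pi'=(P',\mathcal L')$ be the associated $(2n-1)$-dimensional projective spaces. Let $\mathcal G_k$ and $\mathcal G'_k$ be the sets of $k$-dimensional totally isotropic subspaces of $\Pi$ and $\Pi'$. If a mapping $f:\mathcal G_k\to\mathcal G'_k$ sends every base subset of $\mathcal G_k$ to a base subset of $\mathcal G'_k$, then there is a symplectic embedding $h$ of $\Pi$ to $\Pi'$ such that $f(S)=\overline{h(S)}$ for all $S\in\mathcal G_k$.
   Context: Points of $\Pi$ are the $1$-dimensional subspaces of $V$, lines are given by $2$-dimensional subspaces; a $k$-dimensional (projective) subspace of $\Pi$ corresponds to a $(k+1)$-dimensional linear subspace of $V$. Points $p=\langle x\rangle,q=\langle y\rangle$ are orthogonal ($p\perp q$) if $\Omega(x,y)=0$; subspaces $S,U$ are orthogonal if all their points are pairwise orthogonal. A subspace is totally isotropic if any two of its points are orthogonal. A symplectic base of $\Pi$ is a base $\{p_1,\dots,p_{2n}\}$ of $\Pi$ (points $\langle x_i\rangle$ with $x_1,\dots,x_{2n}$ a basis of $V$) such that for each $i$ there is a unique $\sigma(i)$ with $p_i\not\perp p_{\sigma(i)}$. The base subset of $\mathcal G_k$ associated with a symplectic base $B$ is the set of all $k$-dimensional totally isotropic subspaces spanned by points of $B$. The same notions are used for $\Pi'$.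 An embedding of $\Pi$ to $\Pi'$ is an injection $h:P\to P'$ mapping every line into a line such that for each line $L'$ of $\Pi'$ there is at most one line $L$ of $\Pi$ with $h(L)\subset L'$; it is symplectic if it sends symplectic bases of $\Pi$ to symplectic bases of $\Pi'$. $\overline{X}$ denotes the subspace spanned by $X$. *)

(* Defs.v *)
From HB Require Import structures.
From mathcomp Require Import all_boot all_order all_algebra.
From mathcomp Require Import boolp classical_sets.

Set Implicit Arguments.
Unset Strict Implicit.
Unset Printing Implicit Defensive.

Import GRing.Theory.

Local Open Scope ring_scope.
Local Open Scope classical_set_scope.

Section ProjectiveSpace.
Variables (F : fieldType) (V : vectType F).

Definition proj_point := {p : {vspace V} | \dim p == 1%N}.

(* A projective subspace is the set of points of a linear subspace; its
   projective dimension is one less than the dimension of the latter. *)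
Definition points (U : {vspace V}) : set proj_point :=
  [set p | (val p <= U)%VS].

Definition lines : set (set proj_point) :=
  [set points U | U in [set U : {vspace V} | \dim U = 2%N]].

Definition proj_span (X : set proj_point) : set proj_point :=
  smallest (range points) X.

End ProjectiveSpace.

(* [{skew_symmetric V}] alone does not force [Omega x x = 0] in characteristic 2,
   nor nondegeneracy; both come with [is_psymplectic Omega]. *)
Section SymplecticSpace.
Variables (F : fieldType) (V : vectType F) (Omega : {skew_symmetric V}).

Definition perp (p q : proj_point V) :=
  forall x y : V, val p = <[x]>%VS -> val q = <[y]>%VS -> Omega x y = 0.

Definition totally_isotropic (S : {vspace V}) :=
  forall p q : proj_point V, points S p -> points S q -> perp p q.

Definition isotropic_grassmannian (k : nat) : set {vspace V} :=
  [set S | \dim S = k.+1 /\ totally_isotropic S].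

Definition symplectic_base (B : set (proj_point V)) :=
  exists (x : (\dim {:V}).-tuple V) (p : 'I_(\dim {:V}) -> proj_point V),
    [/\ basis_of {:V} x,
        forall i, val (p i) = <[tnth x i]>%VS,
        forall i, exists! j, ~ perp (p i) (p j)
      & B = range p].

Definition base_subset (k : nat) (A : set (isotropic_grassmannian k)) :=
  exists2 B : set (proj_point V), symplectic_base B &
    A = [set S | exists2 X, X `<=` B & points (val S) = proj_span X].

End SymplecticSpace.

Definition embedding (F F' : fieldType) (V : vectType F) (V' : vectType F')
    (h : proj_point V -> proj_point V') :=
  [/\ injective h,
      forall L, lines L -> exists2 L', lines L' & h @` L `<=` L'
    & forall L' L1 L2, lines L' -> lines L1 -> lines L2 ->
        h @` L1 `<=` L' -> h @` L2 `<=` L' -> L1 = L2].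

Definition symplectic_embedding (F F' : fieldType) (V : vectType F)
    (V' : vectType F') (Omega : {skew_symmetric V})
    (Omega' : {skew_symmetric V'}) (h : proj_point V -> proj_point V') :=
  embedding h /\
  forall B, symplectic_base Omega B -> symplectic_base Omega' (h @` B).

(* Main.v *)
(* [f] is injective, so it carries pairs of symplectic bases that differ by a root
   element of the symplectic group to pairs of distinct bases.  Two distinct base
   subsets cannot have common members moved by every root element; hence, on the
   labels of a base, [f] sends the set of members moved by a root element (a set
   [rset]) to a set containing another such set, and so, by finiteness, permutes
   the minimal ones.  When these are singletons this says nothing, and one uses
   instead two bases obtained by putting the same new subspace in the place of
   either of two opposite ones.  It follows that [f] preserves the relation of
   being adjacent and not orthogonal.  Three subspaces pairwise in this relation
   have the same pairwise intersections, so the subspaces through a given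
   (k-1)-dimensional T go to subspaces through some T'; the map from T to T' again
   preserves base subsets, and descending to k = 0 gives [h].  Finally [h]
   preserves both orthogonality and its negation, which makes it an embedding. *)
Require Import Defs.
From mathcomp Require Import all_boot all_order all_algebra zify.
From mathcomp Require Import boolp.

Set Implicit Arguments.
Unset Strict Implicit.
Unset Printing Implicit Defensive.

Import GRing.Theory.

Local Open Scope ring_scope.

(* The labels of the points of a symplectic base: [i] runs over the hyperbolic
   pairs, and [sg] exchanges the two members of a pair. *)
Notation lab n := ('I_n * bool)%type.

Definition sg n (a : lab n) : lab n := (a.1, ~~ a.2).

Section Labels.
Variable n : nat.
Implicit Types (a b c : lab n) (A B X D : {set lab n}).

Lemma sgK : involutive (@sg n).
Proof. by case=> i b; rewrite /sg /= negbK. Qed.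

Lemma sg_inj : injective (@sg n).
Proof. exact: inv_inj sgK. Qed.

Lemma sg_eqC a b : (sg a == b) = (a == sg b).
Proof. by rewrite -(inj_eq sg_inj) sgK. Qed.

Lemma sg_neq a : (sg a == a) = false.
Proof. by case: a => i []; rewrite /sg xpair_eqE /= andbF. Qed.

Definition sgs A : {set lab n} := [set sg x | x in A].

Lemma mem_sg a A : (a \in sgs A) = (sg a \in A).
Proof. by rewrite -{1}(sgK a) mem_imset //; apply: sg_inj. Qed.

Lemma sgsK : involutive sgs.
Proof. by move=> A; apply/setP=> a; rewrite !mem_sg sgK. Qed.

Lemma card_sgs A : #|sgs A| = #|A|.
Proof. exact/card_imset/sg_inj. Qed.

Lemma sgs2 a b : sgs [set a; b] = [set sg a; sg b].
Proof. by rewrite /sgs imsetU !imset_set1. Qed.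

Lemma card_lab : #|[set: lab n]| = (2 * n)%N.
Proof. by rewrite cardsT card_prod card_ord card_bool mulnC. Qed.

Definition consistent A := [forall a in A, sg a \notin A].

Lemma consistent1 a : consistent [set a].
Proof. by apply/forall_inP=> x; rewrite !inE => /eqP->; rewrite sg_neq. Qed.

Lemma consistent2 a b : b != sg a -> consistent [set a; b].
Proof.
move=> ab; apply/forall_inP=> x; rewrite !inE.
case/orP=> /eqP->; rewrite sg_neq /=; first by rewrite eq_sym.
by rewrite sg_eqC orbF.
Qed.

(* The labels of the [k]-dimensional totally isotropic subspaces spanned by a
   symplectic base. *)
Definition csts k : {set {set lab n}} :=
  [set A : {set lab n} | (#|A| == k.+1) && consistent A].

Section Consistent.
Variable k : nat.

Lemma cstsP A :
  reflect (#|A| = k.+1 /\ forall a, a \in A -> sg a \notin A) (A \in csts k).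
Proof.
rewrite inE; apply: (iffP andP) => [[/eqP-> /forall_inP]|[->]] //.
by move=> Asg; split=> //; apply/forall_inP.
Qed.

Lemma consistent_csts A : A \in csts k -> consistent A.
Proof. by case/cstsP=> _ Asg; apply/forall_inP. Qed.

Lemma card_csts A : A \in csts k -> #|A| = k.+1.
Proof. by case/cstsP. Qed.

Lemma csts_sg A a : A \in csts k -> a \in A -> sg a \notin A.
Proof. by case/cstsP=> _; apply. Qed.

Lemma sgs_csts A : A \in csts k -> sgs A \in csts k.
Proof.
move=> Ak; apply/cstsP; rewrite card_sgs (card_csts Ak); split=> // a.
by rewrite !mem_sg; apply: (csts_sg Ak).
Qed.

Lemma disjoint_sgs A : A \in csts k -> [disjoint A & sgs A].
Proof.
move=> Ak; apply/pred0P=> x /=; apply/negP=> /andP[xA]; rewrite mem_sg.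
exact/negP/(csts_sg Ak).
Qed.

Lemma inj_csts (phi : {set lab n} -> {set lab n}) :
    {in csts k, forall A, phi A \in csts k} -> {in csts k &, injective phi} ->
  phi @: csts k = csts k.
Proof.
move=> phik phi_inj; apply/eqP; rewrite eqEcard card_in_imset // leqnn andbT.
by apply/subsetP=> _ /imsetP[A Ak ->]; apply: phik.
Qed.

Lemma csts_extend X D : consistent X -> [disjoint X & D] -> (#|X| <= k.+1)%N ->
    (2 * k.+1 + #|D :&: sgs D| <= 2 * n)%N ->
  exists A, [/\ A \in csts k, X \subset A & [disjoint A & D]].
Proof.
move Er : (k.+1 - #|X|)%N => r; elim: r X Er => [|r IHr] X Er cX XD leX leD.
  exists X; split=> //; apply/cstsP; split; first lia.
  exact/forall_inP.
have [c /and3P[cX' scX cD]] : exists c, [&& c \notin X, sg c \notin X & c \notin D].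
  apply/existsP; rewrite -[X in is_true X]negbK negb_exists.
  apply/negP=> /forallP noc.
  have sub : ~: (X :|: sgs X) \subset D :&: sgs D.
    apply/subsetP=> c; rewrite !inE negb_or !mem_sg => /andP[cX' scX].
    have:= noc c; have:= noc (sg c); rewrite sgK cX' scX /= !negbK.
    by move=> -> ->.
  have := subset_leq_card sub; have := cardsC (X :|: sgs X).
  have [leU _] := leq_card_setU X (sgs X); rewrite card_sgs in leU.
  rewrite -cardsT card_lab; lia.
have card_cX : #|c |: X| = #|X|.+1 by rewrite cardsU1 cX'.
have [|||||A [Ak XA AD]] := IHr (c |: X).
- by rewrite card_cX; lia.
- apply/forall_inP=> a; rewrite !inE negb_or => /orP[/eqP->|aX].
    by rewrite sg_neq.
  rewrite sg_eqC (forall_inP cX) // andbT.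
  by apply: contraNneq scX => <-.
- by rewrite disjoints_subset subUset sub1set inE cD -disjoints_subset.
- by rewrite card_cX; lia.
- by [].
by exists A; split=> //; apply: subset_trans XA; apply: subsetUr.
Qed.

Lemma csts_extend1 X b : consistent X -> b \notin X -> (#|X| <= k.+1)%N ->
  (k < n)%N -> exists A, [/\ A \in csts k, X \subset A & b \notin A].
Proof.
move=> cX bX leX kn.
have [|||A [Ak XA]] := csts_extend (D := [set b]) cX.
- by rewrite disjoint_sym disjoints_subset sub1set inE.
- by [].
- suff -> : [set b] :&: sgs [set b] = set0 by rewrite cards0; lia.
  apply/setP=> x; rewrite !inE mem_sg inE; apply/negP=> /andP[/eqP->].
  by rewrite sg_neq.
by rewrite disjoint_sym disjoints_subset sub1set inE; exists A.
Qed.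

End Consistent.
End Labels.

Lemma vline_scale (F : fieldType) (V : vectType F) (k : F) (v : V) :
  k != 0 -> <[k *: v]>%VS = <[v]>%VS.
Proof.
move=> k0; apply: subv_anti; rewrite -!memvE memvZ ?memv_line //=.
by rewrite -[X in X \in _](scalerK k0) memvZ ?memv_line.
Qed.

Section Forms.
Variables (F : fieldType) (V : vectType F) (Om : {skew_symmetric V}).
Hypothesis sympl : is_psymplectic Om.
Implicit Types (u v w x y : V) (U W S T : {vspace V}).

Lemma formxx x : Om x x = 0.
Proof.
case: sympl => _ _ char2; case: (boolP (2 \in [pchar F])) => [/char2 //|].
rewrite inE /= => nz2; have /eqP := hermC Om x x.
rewrite expr1 mulN1r -addr_eq0 -mulr2n -mulr_natl mulf_eq0.
by rewrite (negPf nz2) => /eqP.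
Qed.

Lemma formC0 x y : Om x y = 0 -> Om y x = 0.
Proof. by move/eqP; rewrite herm_eq0C => /eqP. Qed.

Lemma form_swap x y : Om x y = - Om y x.
Proof. by rewrite hermC expr1 mulN1r. Qed.

Lemma form_vline x v w : w \in <[v]>%VS -> Om x v = 0 -> Om x w = 0.
Proof. by case/vlineP=> k -> xv0; rewrite linearZ /= xv0 mulr0. Qed.

Lemma orthov_addI U W :
  orthov Om (U + W) = (orthov Om U :&: orthov Om W)%VS.
Proof.
apply/vspaceP=> v; rewrite memv_cap.
apply/mem_orthovP/andP => [vUW|[/mem_orthovP vU /mem_orthovP vW] w].
  by split; apply/mem_orthovP=> w ?; apply: vUW;
    [apply: subvP (addvSl _ _) _ _|apply: subvP (addvSr _ _) _ _].
by case/memv_addP=> u uU [w' w'W ->]; rewrite linearD /= vU // vW // addr0.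
Qed.

Lemma dim_cap_orthov U W : (\dim U <= \dim (U :&: orthov Om W) + \dim W)%N.
Proof.
rewrite -(span_basis (vbasisP W)) (eqnP (basis_free (vbasisP W))).
elim: (vbasis W : seq V) => [|x s IHs].
  by rewrite span_nil orthov0 capvf addn0.
rewrite span_cons orthov_addI [(orthov _ _ :&: _)%VS]capvC capvA /=.
by have := leq_dim_orthov1 Om x (U :&: orthov Om <<s>>); lia.
Qed.

Lemma dim_orthov U : (\dim (orthov Om U) + \dim U = \dim {:V})%N.
Proof.
have := dim_cap_orthov fullv U; rewrite capfv.
have := dim_cap_orthov (orthov Om U) (U^C)%VS.
suff -> : (orthov Om U :&: orthov Om U^C = 0)%VS.
  by rewrite dimv0 dimv_compl; have := dimvS (subvf U); lia.
case: sympl => /eqP rad0 _ _; apply/eqP; rewrite -subv0 -rad0 -(addv_complf U).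
by rewrite orthov_addI subvv.
Qed.

Lemma separate U x : x \notin U ->
  exists y, [/\ Om x y != 0 & forall u, u \in U -> Om y u = 0].
Proof.
move=> xU.
have /subvPn[y yU yx] : ~~ (orthov Om U <= orthov Om <[x]>)%VS.
  apply: contraTN isT => sub; have := dim_orthov (U + <[x]>).
  have -> : orthov Om (U + <[x]>) = orthov Om U.
    by rewrite orthov_addI; apply/capv_idPl.
  have := dim_orthov U; rewrite dimv_disjoint_sum.
    have -> : \dim <[x]> = 1%N.
      by rewrite dim_vline; case: eqP xU => [->|//]; rewrite mem0v.
    lia.
  apply/eqP; rewrite -subv0; apply/subvP=> v; rewrite memv_cap => /andP[vU].
  case/vlineP=> k vE; rewrite memv0; apply: contraNT xU; rewrite vE in vU *.
  rewrite scaler_eq0 negb_or => /andP[k0 _].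
  by rewrite -(scalerK k0 x) memvZ.
exists y; split; first by rewrite mem_orthov1 herm_eq0C in yx.
by move/mem_orthovP: yU.
Qed.

End Forms.

Section Frames.
Variables (F : fieldType) (V : vectType F) (Om : {skew_symmetric V}).
Variable n : nat.
Hypothesis dimV : \dim {:V} = (2 * n)%N.
Implicit Types (u v w x y : V) (U W S T : {vspace V}).
Implicit Types (a b c : lab n) (A B X D : {set lab n}) (e d : lab n -> V).

Definition frame e := forall a b, (Om (e a) (e b) != 0) = (b == sg a).

Definition cspan e A := (\sum_(a in A) <[e a]>)%VS.

Lemma cspanU e A B : cspan e (A :|: B) = (cspan e A + cspan e B)%VS.
Proof.
apply: subv_anti; rewrite subv_add; apply/andP; split.
  apply/subv_sumP=> a; rewrite inE => /orP[aA|aB].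
    by apply: subv_trans (addvSl _ _); rewrite (sumv_sup a).
  by apply: subv_trans (addvSr _ _); rewrite (sumv_sup a).
by apply/andP; split; apply/subv_sumP=> a aX; rewrite (sumv_sup a) // inE aX ?orbT.
Qed.

Lemma cspan0 e : cspan e finset.set0 = 0%VS.
Proof. by rewrite /cspan big_set0. Qed.

Lemma cspan1 e a : cspan e [set a] = <[e a]>%VS.
Proof. by rewrite /cspan big_set1. Qed.

Section OneFrame.
Variable e : lab n -> V.
Hypothesis fe : frame e.

Lemma frame0 a b : b != sg a -> Om (e a) (e b) = 0.
Proof. by rewrite -fe negbK => /eqP. Qed.

Lemma frame_sg a : Om (e (sg a)) (e a) != 0.
Proof. by rewrite fe sgK. Qed.

Lemma frame_neq0 a : e a != 0.
Proof. by apply: contraTneq (frame_sg a) => ->; rewrite linear0 eqxx. Qed.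

Lemma form_sum (vs : lab n -> V) A c :
  (forall a, a \in A -> vs a \in <[e a]>%VS) -> c \in A ->
  Om (e (sg c)) (\sum_(a in A) vs a) = Om (e (sg c)) (vs c).
Proof.
move=> vsP cA; rewrite linear_sum (bigD1 c) //= big1 ?addr0 // => a.
case/andP=> aA ac; apply: form_vline (vsP _ aA) (frame0 _).
by rewrite sgK.
Qed.

Lemma frame_line0 c v : v \in <[e c]>%VS -> Om (e (sg c)) v = 0 -> v = 0.
Proof.
case/vlineP=> k -> /eqP; rewrite linearZ /= mulf_eq0 (negPf (frame_sg c)) orbF.
by move/eqP->; rewrite scale0r.
Qed.

Lemma dim_cspan A : \dim (cspan e A) = #|A|.
Proof.
have /directvP/= -> : directv (\sum_(a in A) <[e a]>).
  apply/directv_sum_independent=> vs vsP sum0 c cA.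
  by apply: frame_line0 (vsP _ cA) _; rewrite -(form_sum vsP cA) sum0 linear0.
by rewrite -sum1_card; apply: eq_bigr => a _; rewrite dim_vline frame_neq0.
Qed.

Lemma cspanT : cspan e [set: lab n] = fullv.
Proof.
apply/eqP; rewrite eqEdim subvf dim_cspan dimV cardsT card_prod card_ord.
by rewrite card_bool mulnC leqnn.
Qed.

Lemma cspanP A v :
  reflect (forall c, c \notin A -> Om (e (sg c)) v = 0) (v \in cspan e A).
Proof.
apply: (iffP idP) => [/memv_sumP[vs vsP ->] c cA|vA].
  rewrite linear_sum big1 // => a aA.
  apply: form_vline (vsP _ aA) (frame0 _); rewrite sgK.
  by apply: contraNneq cA => <-.
have: v \in cspan e [set: lab n] by rewrite cspanT memvf.
case/memv_sumP=> vs vsP vE; rewrite vE; apply: memv_suml => c _.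
have [cA|cA] := boolP (c \in A).
  by rewrite memvE (subv_trans (vsP _ (in_setT c))) // (sumv_sup c).
rewrite (frame_line0 (vsP _ (in_setT c))) ?mem0v //.
by rewrite -(form_sum vsP (in_setT c)) -vE vA.
Qed.

Lemma frame_mem a A : (e a \in cspan e A) = (a \in A).
Proof.
apply/cspanP/idP => [eaA|aA c cA].
  by apply: contraT => /eaA/eqP; rewrite (negPf (frame_sg a)).
by apply: frame0; rewrite sgK; apply: contraNneq cA => <-.
Qed.

Lemma cspan_sub A B : (cspan e A <= cspan e B)%VS = (A \subset B).
Proof.
apply/idP/subsetP => [/subvP AB a aA|AB].
  by rewrite -frame_mem AB ?frame_mem.
by apply/subv_sumP=> a aA; rewrite -memvE frame_mem AB.
Qed.

Lemma cspan_inj : injective (cspan e).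
Proof. by move=> A B /eqP; rewrite eqEsubv !cspan_sub -eqEsubset => /eqP. Qed.

Lemma cspanI A B : cspan e (A :&: B) = (cspan e A :&: cspan e B)%VS.
Proof.
apply/vspaceP=> v; rewrite memv_cap; apply/cspanP/andP.
  by move=> vAB; split; apply/cspanP=> c cX; apply: vAB; rewrite inE (negPf cX) ?andbF.
by case=> /cspanP vA /cspanP vB c; rewrite inE negb_and => /orP[/vA|/vB].
Qed.

Lemma cspanC A v : (v \in cspan e (~: sgs A)) <->
  (forall u, u \in cspan e A -> Om u v = 0).
Proof.
split=> [/cspanP vA u /memv_sumP[us usP ->]|vA].
  rewrite linear_sumlz big1 // => a aA.
  apply/formC0/(form_vline (usP _ aA))/formC0.
  by rewrite -(sgK a) vA // inE mem_sg sgK aA.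
apply/cspanP=> c; rewrite inE negbK mem_sg => cA.
by apply: vA; rewrite frame_mem.
Qed.

End OneFrame.
End Frames.

Section CommonFrame.
Variables (F : fieldType) (V : vectType F) (Om : {skew_symmetric V}).
Hypothesis sympl : is_psymplectic Om.
Variable n : nat.
Hypothesis dimV : \dim {:V} = (2 * n)%N.
Implicit Types (u v w x y : V) (U W S T P Z : {vspace V}).
Implicit Types (a b c : lab n) (A B : {set lab n}) (e d : lab n -> V).

Definition isotropic U := (U <= orthov Om U)%VS.

Definition pframe m e := forall a b, (a.1 < m)%N -> (b.1 < m)%N ->
  (Om (e a) (e b) != 0) = (b == sg a).

Local Notation below m := ([set a : lab n | (a.1 < m)%N]).

Lemma pframe_orthov m e v : pframe m e -> v \in cspan e (below m) ->
  v \in orthov Om (cspan e (below m)) -> v = 0.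
Proof.
move=> fe /memv_sumP[vs vsP vE] /mem_orthovP orth; rewrite vE big1 // => c cm.
have cm' : (c.1 < m)%N by rewrite inE in cm.
have escP : e (sg c) \in cspan e (below m).
  by rewrite memvE (sumv_sup (sg c)) // inE.
have := formC0 (orth _ escP); rewrite vE linear_sum (bigD1 c) //= big1.
  have /vlineP[k ->] := vsP c cm; rewrite addr0 linearZ /= => /eqP.
  rewrite mulf_eq0 -[Om _ _ == 0]negbK fe //= sgK eqxx orbF => /eqP->.
  by rewrite scale0r.
move=> a /andP[am ac]; apply: form_vline (vsP _ am) _.
apply/eqP; rewrite -[_ == 0]negbK fe //; last by rewrite inE in am.
by rewrite sgK.
Qed.

Definition splittable x y Z :=
  [\/ x \in Z, y \in Z | (Z <= orthov Om <[x]>)%VS && (Z <= orthov Om <[y]>)%VS].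

Lemma hyperbolic_pair P S U :
    (forall v, v \in P -> v \in orthov Om P -> v = 0) -> (\dim P < \dim {:V})%N ->
    (S <= orthov Om P)%VS -> (U <= orthov Om P)%VS ->
  exists x y, [/\ Om x y != 0, x \in orthov Om P, y \in orthov Om P,
    splittable x y S & splittable x y U].
Proof.
move=> Pnd Plt SP UP.
have notP x : x != 0 -> x \in orthov Om P -> x \notin P.
  by move=> x0 xo; apply: contraNN x0 => xP; rewrite (Pnd x).
have memP x : (forall u, u \in P -> Om x u = 0) -> x \in orthov Om P.
  by move=> xo; apply/mem_orthovP.
have [SU|/subvPn[x xS]] := boolP (S <= orthov Om U)%VS; last first.
  case/mem_orthovPn=> y yU xy; exists x, y; split=> //;
    [exact: subvP SP _ xS|exact: subvP UP _ yU|exact: Or31|exact: Or32].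
have [SU0|] := eqVneq (S :&: U)%VS 0%VS; last first.
  rewrite -vpick0; have := memv_pick (S :&: U); move: (vpick _) => x.
  rewrite memv_cap => /andP[xS xU] x0; have xP := subvP SP _ xS.
  have [y [xy yP]] := separate sympl (notP x x0 xP).
  by exists x, y; split=> //; [exact: memP|exact: Or31|exact: Or31].
have [S0|] := eqVneq S 0%VS; last first.
  rewrite -vpick0; have := memv_pick S; move: (vpick _) => x xS x0.
  have xP := subvP SP _ xS.
  have xPU : x \notin (P + U)%VS.
    apply/negP=> /memv_addP[p pP [u uU xE]].
    have p0 : p = 0.
      by apply: Pnd => //; rewrite -(addrK u p) -xE memvB // (subvP UP).
    have : x \in (S :&: U)%VS by rewrite memv_cap xS xE p0 add0r uU.
    by rewrite SU0 memv0 (negPf x0).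
  have [y [xy yPU]] := separate sympl xPU; exists x, y; split=> //.
  - by apply: memP => u uP; apply: yPU; apply: subvP (addvSl _ _) _ uP.
  - exact: Or31.
  apply/Or33/andP; split; rewrite orthov_sym -memvE; first exact: (subvP SU).
  by apply/mem_orthovP=> u uU; apply: yPU; apply: subvP (addvSr _ _) _ uU.
have split0 x y : splittable x y 0%VS by apply: Or33; rewrite !sub0v.
have [U0|] := eqVneq U 0%VS; last first.
  rewrite -vpick0; have := memv_pick U; move: (vpick _) => x xU x0.
  have xP := subvP UP _ xU.
  have [y [xy yP]] := separate sympl (notP x x0 xP).
  by exists x, y; split=> //; [exact: memP|rewrite S0|exact: Or31].
have : orthov Om P != 0%VS.
  by rewrite -dimv_eq0; have := dim_orthov sympl P; lia.
rewrite -vpick0; have := memv_pick (orthov Om P); move: (vpick _) => x xP x0.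
have [y [xy yP]] := separate sympl (notP x x0 xP).
by exists x, y; split=> //; [exact: memP|rewrite S0|rewrite U0].
Qed.

Lemma split_vline x y Z : Om x y != 0 -> isotropic Z -> x \in Z ->
  [/\ (Z :&: orthov Om <[y]> <= orthov Om <[x]>)%VS
    & Z = (<[x]> + Z :&: orthov Om <[y]>)%VS].
Proof.
move=> xy isoZ xZ; split.
  by apply: subv_trans (capvSl _ _) _; rewrite orthov_sym -memvE (subvP isoZ).
apply: subv_anti; rewrite subv_add -memvE xZ capvSl !andbT.
apply/subvP=> z zZ; pose k := Om z y / Om x y.
rewrite -(subrK (k *: x) z) addrC memv_add ?memvZ ?memv_line //.
rewrite memv_cap memvB ?memvZ //= mem_orthov1 linearBl /= linearZl_LR /=.
by rewrite divfK // subrr.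
Qed.

Lemma split_splittable x y Z : Om x y != 0 -> isotropic Z -> splittable x y Z ->
  exists Z1 (p : bool * bool), [/\ (Z1 <= Z)%VS, (Z1 <= orthov Om <[x]>)%VS,
     (Z1 <= orthov Om <[y]>)%VS
   & Z = ((if p.1 then <[x]> else 0) + (if p.2 then <[y]> else 0) + Z1)%VS].
Proof.
move=> xy isoZ [xZ|yZ|/andP[Zx Zy]].
- have [Zx ZE] := split_vline xy isoZ xZ; exists (Z :&: orthov Om <[y]>)%VS.
  by exists (true, false); rewrite addv0 capvSl capvSr -ZE.
- have yx : Om y x != 0 by rewrite herm_eq0C.
  have [Zy ZE] := split_vline yx isoZ yZ; exists (Z :&: orthov Om <[x]>)%VS.
  by exists (false, true); rewrite add0v capvSl capvSr -ZE.
by exists Z, (false, false); rewrite !add0v.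
Qed.

Lemma isotropicS U W : (U <= W)%VS -> isotropic W -> isotropic U.
Proof.
move=> UW /orthovP isoW; apply/orthovP=> u v uU vU.
by apply: isoW; apply: (subvP UW).
Qed.

Lemma extend_pframe m e S U : (m <= n)%N -> pframe m e ->
    isotropic S -> isotropic U ->
    (S <= orthov Om (cspan e (below m)))%VS ->
    (U <= orthov Om (cspan e (below m)))%VS ->
  exists d A B, [/\ frame Om d, forall a, (a.1 < m)%N -> d a = e a,
    S = cspan d A & U = cspan d B].
Proof.
move Er : (n - m)%N => r mn.
elim: r m e S U mn Er => [|r IHr] m e S U mn Er fe isoS isoU.
  have {Er}mE : m = n by lia.
  have {}fe : frame Om e by move=> a b; apply: fe; rewrite mE.
  have -> : below m = [set: lab n] by apply/setP=> a; rewrite !inE mE ltn_ord.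
  rewrite (cspanT dimV fe) => S0 U0.
  suff W0 W : (W <= orthov Om fullv)%VS -> W = cspan e finset.set0.
    by exists e, finset.set0, finset.set0; split=> //; apply: W0.
  by case: sympl => /eqP-> _ _; rewrite subv0 cspan0 => /eqP.
set P := cspan e (below m) => SP UP.
have Pnd v : v \in P -> v \in orthov Om P -> v = 0 by apply: pframe_orthov.
have Plt : (\dim P < \dim {:V})%N.
  have le_dim : (\dim P <= #|below m|)%N.
    rewrite (leq_trans (dimv_leq_sum _ _ _)) // -sum1_card leq_sum // => a _.
    by rewrite dim_vline leq_b1.
  apply: leq_ltn_trans le_dim _.
  have -> : \dim {:V} = #|[set: lab n]|.
    by rewrite cardsT card_prod card_ord card_bool dimV mulnC.
  have mn' : (m < n)%N by rewrite -subn_gt0 Er.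
  apply: proper_card; apply/properP; split; first exact: subsetT.
  by exists (Ordinal mn', true); rewrite !inE //= ltnn.
have [x [y [xy xP yP Ssp Usp]]] := hyperbolic_pair Pnd Plt SP UP.
have [S1 [p [S1S S1x S1y SE]]] := split_splittable xy isoS Ssp.
have [U1 [q [U1U U1x U1y UE]]] := split_splittable xy isoU Usp.
have mn' : (m < n)%N by rewrite -subn_gt0 Er.
pose i := Ordinal mn'.
pose e1 a := if a.1 == i then (if a.2 then x else y) else e a.
have e1i t : e1 (i, t) = if t then x else y by rewrite /e1 eqxx.
have e1P a : (a.1 < m)%N -> e1 a = e a.
  by rewrite /e1; case: eqP => //= ->; rewrite ltnn.
have e1n a t : (a.1 < m)%N -> Om (e1 (i, t)) (e a) = 0.
  move=> am; have eaP : e a \in P by rewrite memvE (sumv_sup a) // inE.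
  rewrite e1i; case: t.
    by move/mem_orthovP: xP; apply.
  by move/mem_orthovP: yP; apply.
have fe1 : pframe m.+1 e1.
  have sgi t (a : lab n) : (a.1 < m)%N -> (a == sg (i, t)) = false.
    by case: a => j c /= jm; apply/eqP=> -[ji _]; rewrite ji ltnn in jm.
  have lt a : (a.1 < m.+1)%N -> (exists t, a = (i, t)) \/ (a.1 < m)%N.
    case: a => j t /=; rewrite ltnS leq_eqVlt => /orP[/eqP ji|]; last by right.
    by left; exists t; congr (_, _); apply: val_inj.
  move=> a b /lt[[s ->]|am] /lt[[t ->]|bm].
  - rewrite !e1i /sg xpair_eqE eqxx /=.
    by case: s; case: t; rewrite ?(formxx sympl) ?eqxx // herm_eq0C.
  - by rewrite (e1P b) // e1n // eqxx sgi.
  - by rewrite (e1P a) // (formC0 (e1n _ _ am)) eqxx eq_sym sg_eqC sgi.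
  by rewrite !e1P // fe.
have S1P : (S1 <= orthov Om P)%VS by apply: subv_trans S1S SP.
have U1P : (U1 <= orthov Om P)%VS by apply: subv_trans U1U UP.
have PE : (cspan e1 (below m.+1) <= P + (<[x]> + <[y]>))%VS.
  apply/subv_sumP=> a; rewrite inE ltnS leq_eqVlt => /orP[/eqP ai|am].
    apply: subv_trans (addvSr _ _).
    rewrite /e1 (_ : a.1 = i) ?eqxx; last exact: val_inj.
    by case: (a.2); [apply: addvSl|apply: addvSr].
  by apply: subv_trans (addvSl _ _); rewrite e1P // (sumv_sup a) // inE.
have toP1 Z : (Z <= orthov Om P)%VS -> (Z <= orthov Om <[x]>)%VS ->
    (Z <= orthov Om <[y]>)%VS -> (Z <= orthov Om (cspan e1 (below m.+1)))%VS.
  move=> ZP Zx Zy; rewrite orthov_sym (subv_trans PE) // orthov_sym.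
  by rewrite !orthovD ZP Zx Zy.
have [d [A [B [fd dE S1E U1E]]]] : exists d A B, [/\ frame Om d,
    forall a, (a.1 < m.+1)%N -> d a = e1 a, S1 = cspan d A & U1 = cspan d B].
  apply: IHr; first exact: mn'; first by rewrite subnS Er.
  - exact: fe1.
  - exact: isotropicS isoS.
  - exact: isotropicS isoU.
  - exact: toP1.
  - exact: toP1.
have dx : d (i, true) = x by rewrite dE ?e1i /=.
have dy : d (i, false) = y by rewrite dE ?e1i /=.
pose pick (t : bool * bool) : {set lab n} :=
  (if t.1 then [set (i, true)] else finset.set0) :|:
  (if t.2 then [set (i, false)] else finset.set0).
have pickE t : cspan d (pick t) =
    ((if t.1 then <[x]> else 0) + (if t.2 then <[y]> else 0))%VS.
  by rewrite cspanU; case: t => [[] []] /=; rewrite ?cspan1 ?cspan0 ?dx ?dy.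
exists d, (pick p :|: A), (pick q :|: B); split=> //.
- by move=> a am; rewrite dE ?e1P // ltnW.
- by rewrite SE cspanU pickE S1E.
- by rewrite UE cspanU pickE U1E.
Qed.

Lemma common_frame S U : isotropic S -> isotropic U ->
  exists e A B, [/\ frame Om e, S = cspan e A & U = cspan e B].
Proof.
move=> isoS isoU.
have below0 : below 0 = finset.set0 by apply/setP=> a; rewrite !inE.
have pf0 : pframe 0 (fun=> 0) by [].
have orth0 Z : (Z <= orthov Om (cspan (fun=> 0%R) (below 0)))%VS.
  by rewrite below0 cspan0 orthov0 subvf.
have [d [A [B [fd _ SE UE]]]] :=
  extend_pframe (leq0n n) pf0 isoS isoU (orth0 S) (orth0 U).
by exists d, A, B.
Qed.
End CommonFrame.

Section Roots.
Variables n k : nat.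
Implicit Types (a b c d : lab n) (A B X D : {set lab n}).
Implicit Types (R : {set {set lab n}}).

(* The root element [e_a -> e_a + e_b], [e_(sg b) -> e_(sg b) + t e_(sg a)] of
   the symplectic group moves exactly the members of the base subset of [e] with
   label in [rset a b]; for [b = sg a] it is a transvection (a long root). *)
Definition rset a b : {set {set lab n}} :=
  [set A in csts n k | (a \in A) && (b \notin A) || (sg b \in A) && (sg a \notin A)].

Lemma rsetN a b : rset (sg b) (sg a) = rset a b.
Proof. by apply/setP=> A; rewrite !inE !sgK orbC. Qed.

Lemma rset_sub a b : rset a b \subset csts n k.
Proof. by apply/subsetP=> A; rewrite inE => /andP[]. Qed.

Lemma long_rsetE a A : A \in csts n k -> (A \in rset a (sg a)) = (a \in A).
Proof.
move=> Ak; rewrite inE Ak sgK orbb /=; apply: andb_idr.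
exact: (csts_sg Ak).
Qed.

Definition rsets : {set {set {set lab n}}} :=
  [set rset p.1 p.2 | p in [set p : lab n * lab n | p.1 != p.2]].

Lemma rsetsP R : reflect (exists2 p : lab n * lab n, p.1 != p.2 & R = rset p.1 p.2)
  (R \in rsets).
Proof.
apply: (iffP imsetP) => [[p]|[p pN ->]]; last by exists p; rewrite ?inE.
by rewrite inE => pN ->; exists p.
Qed.

Lemma mem_rsets a b : a != b -> rset a b \in rsets.
Proof. by move=> ab; apply/rsetsP; exists (a, b). Qed.

Definition minroots : {set {set {set lab n}}} :=
  [set R in rsets | [forall R' in rsets, (R' \subset R) ==> (R' == R)]].

Definition wadj A B := (#|A :&: B| == k) && [exists a in A, sg a \in B].

Section RootMap.
Variable phi : {set lab n} -> {set lab n}.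
Hypothesis phi_csts : {in csts n k, forall A, phi A \in csts n k}.
Hypothesis phi_inj : {in csts n k &, injective phi}.
Hypothesis phi_roots :
  forall R, R \in rsets -> exists2 R', R' \in rsets & R' \subset phi @: R.

Lemma rsets_sub R : R \in rsets -> R \subset csts n k.
Proof. by case/rsetsP=> p _ ->; apply: rset_sub. Qed.

Lemma mem_phi A R : A \in csts n k -> R \subset csts n k ->
  (phi A \in phi @: R) = (A \in R).
Proof.
move=> Ak /subsetP Rk; apply/imsetP/idP => [[B BR AB]|AR]; last by exists A.
by rewrite (phi_inj Ak (Rk _ BR) AB).
Qed.

Lemma phi_imset_inj :
  {in powerset (csts n k) &, injective (fun R : {set {set lab n}} => phi @: R)}.
Proof.
move=> R R'; rewrite !inE => Rk Rk' RR'; apply/setP=> A.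
have [Ak|Ak] := boolP (A \in csts n k).
  by rewrite -(mem_phi Ak Rk) RR' mem_phi.
by rewrite (contraNF (subsetP Rk A)) // (contraNF (subsetP Rk' A)).
Qed.

Let bigs : {set {set {set lab n}}} :=
  [set R in powerset (csts n k) | [exists R' in rsets, R' \subset R]].

Lemma phi_bigs : [set phi @: (R : {set {set lab n}}) | R in bigs] = bigs.
Proof.
apply/eqP; rewrite eqEcard card_in_imset ?leqnn ?andbT; last first.
  move=> R R'; rewrite ![_ \in bigs]inE => /andP[Rk _] /andP[Rk' _].
  exact: phi_imset_inj.
apply/subsetP=> _ /imsetP[R + ->]; rewrite !inE => /andP[Rk /exists_inP[R0 R0r R0R]].
apply/andP; split.
  by apply/subsetP=> _ /imsetP[A /(subsetP Rk) Ak ->]; apply: phi_csts.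
have [R1 R1r R1R0] := phi_roots R0r; apply/exists_inP; exists R1 => //.
exact: subset_trans R1R0 (imsetS _ R0R).
Qed.

Lemma phi_minroots R : R \in minroots -> phi @: R \in minroots.
Proof.
rewrite inE => /andP[Rr /forall_inP Rmin].
have Rk := rsets_sub Rr.
have minP (X : {set {set lab n}}) : X \in bigs -> X \subset phi @: R -> X = phi @: R.
  rewrite -phi_bigs => /imsetP[R1 + ->]; rewrite !inE.
  case/andP=> R1k /exists_inP[R0 R0r R01] R1R.
  suff /eqP R0R : R0 == R.
    by apply/eqP; rewrite eqEsubset R1R imsetS // -R0R.
  apply: (implyP (Rmin _ R0r)); apply: subset_trans R01 _.
  apply/subsetP=> A AR1; have Ak := subsetP R1k _ AR1.
  by rewrite -(mem_phi Ak Rk) (subsetP R1R) // imset_f.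
have rbig R' : R' \in rsets -> R' \in bigs.
  move=> R'r; rewrite !inE rsets_sub //.
  by apply/exists_inP; exists R'.
have [R' R'r R'R] := phi_roots Rr.
have R'E := minP _ (rbig _ R'r) R'R.
rewrite inE -{1}R'E R'r; apply/forall_inP=> R2 R2r; apply/implyP=> R2R.
exact/eqP/minP/R2R/rbig.
Qed.

Lemma phi_minrootsE : [set phi @: (R : {set {set lab n}}) | R in minroots] = minroots.
Proof.
apply/eqP; rewrite eqEcard card_in_imset ?leqnn ?andbT; last first.
  move=> R R'; rewrite !inE => /andP[/rsets_sub Rk _] /andP[/rsets_sub Rk' _].
  by apply: phi_imset_inj; rewrite inE.
by apply/subsetP=> _ /imsetP[R Rm ->]; apply: phi_minroots.
Qed.

End RootMap.
End Roots.

Section MiddleRoots.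
Variables n k : nat.
Hypotheses (k_gt0 : (0 < k)%N) (k_ltn : (k.+1 < n)%N).
Implicit Types (a b c d : lab n) (A B X D : {set lab n}).
Implicit Types (R : {set {set lab n}}).

Lemma csts_extend2 X D : consistent X -> [disjoint X & D] -> (#|X| <= 2)%N ->
    (#|D :&: sgs D| <= 2)%N ->
  exists A, [/\ A \in csts n k, X \subset A & [disjoint A & D]].
Proof. by move=> cX XD leX leD; apply: csts_extend => //; lia. Qed.

Lemma rset_sub_end a b c d : a != b -> c != d ->
  rset k c d \subset rset k a b -> (c == a) || (c == sg b).
Proof.
move=> ab cd /subsetP sub; apply: contraT; rewrite negb_or => /andP[ca csb].
have [||||A [Ak]] := @csts_extend2 [set c] [set a; sg b; d].
- exact: consistent1.
- by rewrite disjoints_subset sub1set !inE !negb_or ca csb cd.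
- by rewrite cards1.
- apply: leq_trans (_ : #|[set d; sg d]| <= 2)%N; last by rewrite cards2 ltnS leq_b1.
  apply/subset_leq_card/subsetP=> x; rewrite !inE mem_sg !inE !sg_eqC sgK.
  case/andP=> /orP[/orP[]|] /eqP->; rewrite ?eqxx // ?[_ == sg d]sg_eqC.
    by rewrite [a == sg a]eq_sym sg_neq (negPf ab) /= => ->; rewrite orbT.
  rewrite sg_neq orbF sg_eqC sgK [b == _]eq_sym (negPf ab) /= => /eqP->.
  by rewrite sgK eqxx orbT.
rewrite sub1set disjoints_subset => cA /subsetP AD.
have /sub : A \in rset k c d.
  rewrite inE Ak cA /=; apply/orP; left.
  by apply/negP=> /AD; rewrite !inE eqxx !orbT.
rewrite inE Ak /= => /orP[/andP[/AD + _]|/andP[/AD + _]].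
  by rewrite !inE eqxx.
by rewrite !inE eqxx orbT.
Qed.

Lemma short_sub_long a b : b != sg a -> a != b ->
  ~~ (rset k a (sg a) \subset rset k a b).
Proof.
move=> bsa ab; apply/subsetPn.
have [||||A [Ak]] := @csts_extend2 [set a; b] set0.
- exact: consistent2.
- by rewrite disjoints_subset setC0 subsetT.
- by rewrite cards2 ltnS leq_b1.
- by rewrite set0I cards0.
rewrite subUset !sub1set => /andP[aA bA] _.
exists A; first by rewrite long_rsetE.
by rewrite inE aA bA /= (negPf (csts_sg Ak bA)) /= andbF.
Qed.

Lemma rset_incl a b c d : a != b -> c != d -> rset k c d \subset rset k a b ->
  (c, d) = (a, b) \/ (c, d) = (sg b, sg a).
Proof.
move=> ab cd sub.
have := rset_sub_end ab cd sub.
have sub' : rset k (sg d) (sg c) \subset rset k a b by rewrite rsetN.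
have := rset_sub_end ab _ sub'; rewrite (inj_eq (@sg_inj n)) eq_sym => /(_ cd).
rewrite !sg_eqC sgK => /orP[] /eqP dE /orP[] /eqP cE; subst c d.
- have [->|bsa] := eqVneq b (sg a); first by left.
  by case/negP: (short_sub_long bsa ab).
- by right.
- by left.
have [->|bsa] := eqVneq b (sg a); first by left; rewrite sgK.
have sab : sg b != sg a by rewrite (inj_eq (@sg_inj n)) eq_sym.
have bsa' : sg a != sg (sg b) by rewrite sgK eq_sym.
case/negP: (short_sub_long bsa' sab).
by rewrite sgK (rsetN _ a b).
Qed.

Lemma rset_eq a b c d : a != b -> c != d -> rset k c d = rset k a b ->
  (c, d) = (a, b) \/ (c, d) = (sg b, sg a).
Proof. by move=> ab cd E; apply: rset_incl => //; rewrite E. Qed.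

Lemma minroots_middle : minroots n k = rsets n k.
Proof.
apply/setP=> R; rewrite inE; apply: andb_idr => /rsetsP[[a b] /= ab ->].
apply/forall_inP=> _ /rsetsP[[c d] /= cd ->]; apply/implyP=> sub.
by case: (rset_incl ab cd sub) => -[-> ->]; rewrite ?rsetN.
Qed.

Lemma short_disjoint a b c d : a != b -> b != sg a -> c != d ->
  [disjoint rset k a b & rset k c d] ->
  rset k c d \in [set rset k b a; rset k b (sg b); rset k (sg a) a].
Proof.
move=> ab bsa cd dis.
have no A : A \in rset k a b -> A \in rset k c d -> False.
  by move=> Aab Acd; move/pred0P/(_ A): dis; rewrite /= Aab Acd.
have meet x y z t : x <> y -> z <> sg x -> t <> x -> t <> z -> y <> z ->
    exists A, [/\ A \in csts n k, x \in A, z \in A, y \notin A & t \notin A].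
  move=> /eqP xy /eqP zx /eqP tx /eqP tz /eqP yz.
  have [||||A [Ak]] := @csts_extend2 [set x; z] [set y; t].
  - exact: consistent2.
  - rewrite disjoints_subset subUset !sub1set !inE !negb_or.
    by rewrite xy eq_sym tx eq_sym yz eq_sym tz.
  - by rewrite cards2 ltnS leq_b1.
  - apply: leq_trans (subset_leq_card (subsetIl _ _)) _.
    by rewrite cards2 ltnS leq_b1.
  rewrite subUset !sub1set disjoints_subset => /andP[xA zA] /subsetP AD.
  by exists A; split=> //; apply/negP=> /AD; rewrite !inE eqxx ?orbT.
have sgKn := @sgK n; rewrite /involutive /cancel in sgKn.
move/eqP in ab; move/eqP in bsa; move/eqP in cd.
have e1 : a = d \/ c = sg a \/ c = b.
  have [->|/eqP ad] := eqVneq a d; first by left.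
  have [->|/eqP ca] := eqVneq c (sg a); first by right; left.
  have [->|/eqP cb] := eqVneq c b; first by right; right.
  have [||||| A [Ak aA cA bA dA]] := @meet a b c d; try congruence.
  by case: (no A); rewrite inE Ak ?aA ?bA ?cA ?dA.
have e2 : a = d \/ c = sg a \/ d = sg b.
  have [->|/eqP ad] := eqVneq a d; first by left.
  have [->|/eqP ca] := eqVneq c (sg a); first by right; left.
  have [->|/eqP db] := eqVneq d (sg b); first by right; right.
  have [||||| A [Ak aA dA bA cA]] := @meet a b (sg d) (sg c); try congruence.
  by case: (no A); rewrite inE Ak ?aA ?bA ?cA ?dA ?orbT.
have e3 : c = sg a \/ c = b \/ d = sg b.
  have [->|/eqP ca] := eqVneq c (sg a); first by left.
  have [->|/eqP cb] := eqVneq c b; first by right; left.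
  have [->|/eqP db] := eqVneq d (sg b); first by right; right.
  have [||||| A [Ak bA cA aA dA]] := @meet (sg b) (sg a) c d; try congruence.
  by case: (no A); rewrite inE Ak ?aA ?bA ?cA ?dA ?orbT.
have e4 : d = a \/ c = b \/ d = sg b.
  have [->|/eqP ad] := eqVneq d a; first by left.
  have [->|/eqP cb] := eqVneq c b; first by right; left.
  have [->|/eqP db] := eqVneq d (sg b); first by right; right.
  have [||||| A [Ak bA dA aA cA]] := @meet (sg b) (sg a) (sg d) (sg c); try congruence.
  by case: (no A); rewrite inE Ak ?aA ?bA ?cA ?dA ?orbT.
have [|[|]] : (c = b /\ d = a) \/ (c = b /\ d = sg b) \/
    (c = sg a /\ d = a) \/ (c = sg a /\ d = sg b) by intuition congruence.
- by case=> -> ->; rewrite !inE eqxx.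
- by case=> -> ->; rewrite !inE eqxx ?orbT.
by case=> -[-> ->]; rewrite ?rsetN !inE eqxx ?orbT.
Qed.

Definition opp_degree R := #|[set R' in minroots n k | [disjoint R & R']]|.

Lemma opp_degree_long a : (3 < opp_degree (rset k a (sg a)))%N.
Proof.
have rinj : {in ~: [set a] &, injective (fun b => rset k b a)}.
  move=> b c; rewrite !inE => ba ca E.
  have [] := rset_eq ca ba E => -[-> // E2].
  by rewrite E2 sgK.
suff : (#|[set rset k b a | b in ~: [set a]]| <= opp_degree (rset k a (sg a)))%N.
  rewrite card_in_imset //; have := cardsC [set a].
  rewrite -cardsT card_lab cards1; lia.
apply/subset_leq_card/subsetP=> _ /imsetP[b + ->]; rewrite inE inE => ba.
rewrite inE minroots_middle mem_rsets //=; apply/pred0P=> A /=; apply/negP.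
case/andP=> Aa; have Ak := subsetP (rset_sub _ _ _) _ Aa.
rewrite long_rsetE // in Aa; rewrite inE Ak Aa /= andbF /=.
by rewrite (negPf (csts_sg Ak Aa)).
Qed.

Lemma opp_degree_short a b : a != b -> b != sg a ->
  (opp_degree (rset k a b) <= 3)%N.
Proof.
move=> ab bsa.
apply: leq_trans (_ : #|[set rset k b a; rset k b (sg b); rset k (sg a) a]| <= 3)%N.
  apply/subset_leq_card/subsetP=> R; rewrite inE minroots_middle.
  by case/andP=> /rsetsP[[c d] /= cd ->]; apply: short_disjoint.
rewrite setUC cardsU1 cards2.
by case: (_ \notin _); case: (_ != _).
Qed.

Section MiddleMap.
Variable phi : {set lab n} -> {set lab n}.
Hypothesis phi_csts : {in csts n k, forall A, phi A \in csts n k}.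
Hypothesis phi_inj : {in csts n k &, injective phi}.
Hypothesis phi_rsets : forall R, R \in rsets n k ->
  exists2 R', R' \in rsets n k & R' \subset phi @: R.

Lemma opp_degree_phi R : R \in rsets n k -> opp_degree (phi @: R) = opp_degree R.
Proof.
move=> Rr; have Rk := rsets_sub Rr; rewrite /opp_degree.
have minsub R' : R' \in minroots n k -> R' \subset csts n k.
  by rewrite inE => /andP[/rsets_sub].
have -> : [set R' in minroots n k | [disjoint phi @: R & R']] =
    [set phi @: (R' : {set {set lab n}}) |
      R' in [set R' in minroots n k | [disjoint R & R']]].
  have disE R' : R' \subset csts n k ->
      [disjoint phi @: R & phi @: R'] = [disjoint R & R'].
    move=> R'k; apply/pred0P/pred0P => dis A /=; apply/negP=> /andP[].
      move=> AR AR'; have := dis (phi A); have Ak := subsetP Rk _ AR.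
      by rewrite /= !(mem_phi phi_inj) ?AR ?AR'.
    case/imsetP=> A' A'R ->; have Ak := subsetP Rk _ A'R.
    rewrite (mem_phi phi_inj) // => A'R'.
    by have := dis A'; rewrite /= A'R A'R'.
  apply/setP=> R1; rewrite inE -{1}(phi_minrootsE phi_csts phi_inj phi_rsets).
  apply/andP/imsetP => [[/imsetP[R2 R2m ->]]|[R2]].
    by rewrite disE ?minsub // => dis; exists R2; rewrite // inE R2m.
  rewrite inE => /andP[R2m dis] ->; rewrite disE ?minsub //; split=> //.
  exact: imset_f.
rewrite card_in_imset // => R1 R2 /setIdP[/minsub R1k _] /setIdP[/minsub R2k _].
by apply: (phi_imset_inj phi_inj); rewrite inE.
Qed.

Lemma phi_long a : exists b, phi @: rset k a (sg a) = rset k b (sg b).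
Proof.
have asa : a != sg a by rewrite eq_sym sg_neq.
have am := mem_rsets k asa.
have : phi @: rset k a (sg a) \in minroots n k.
  by apply: phi_minroots => //; rewrite minroots_middle.
rewrite minroots_middle => /rsetsP[[b c] /= bc E].
have [cE|cb] := eqVneq c (sg b); first by exists b; rewrite E cE.
have := opp_degree_short bc cb; rewrite -E opp_degree_phi //.
by rewrite leqNgt opp_degree_long.
Qed.

Lemma wadj_middle A B : A \in csts n k -> B \in csts n k -> wadj k A B ->
  wadj k (phi A) (phi B).
Proof.
have [p pE] := choice phi_long.
have mem_p C a : C \in csts n k -> (p a \in phi C) = (a \in C).
  move=> Ck; rewrite -(@long_rsetE n k (p a)) ?phi_csts // -pE.
  by rewrite (mem_phi phi_inj) ?rset_sub // long_rsetE.
have p_inj : injective p.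
  move=> a b pab.
  have asa c : c != sg c by rewrite eq_sym sg_neq.
  have E : rset k a (sg a) = rset k b (sg b).
    by apply: (phi_imset_inj phi_inj); rewrite ?inE ?rset_sub // !pE pab.
  by case: (rset_eq (asa b) (asa a) E) => -[-> //]; rewrite sgK.
have phiE C : C \in csts n k -> phi C = p @: C.
  move=> Ck; apply/esym/eqP; rewrite eqEcard (card_csts (phi_csts Ck)).
  rewrite card_imset // (card_csts Ck) leqnn andbT.
  by apply/subsetP=> _ /imsetP[c cC ->]; rewrite mem_p.
have phi_onto C : C \in csts n k -> exists2 D, D \in csts n k & C = phi D.
  by rewrite -{1}(inj_csts phi_csts phi_inj) => /imsetP[D Dk ->]; exists D.
have p_sg a : p (sg a) = sg (p a).
  apply/eqP; apply: contraT => pa.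
  have [||||C [Ck]] := @csts_extend2 [set p a; p (sg a)] set0.
  - exact: consistent2.
  - by rewrite disjoints_subset setC0 subsetT.
  - by rewrite cards2 ltnS leq_b1.
  - by rewrite set0I cards0.
  rewrite subUset !sub1set; have [D Dk ->] := phi_onto C Ck.
  rewrite !mem_p // => /andP[aD saD] _.
  by rewrite (negPf (csts_sg Dk aD)) in saD.
move=> Ak Bk /andP[cAB /exists_inP[a aA saB]]; apply/andP; split.
  by rewrite !phiE // -imsetI ?card_imset // => x y _ _; apply: p_inj.
by apply/exists_inP; exists (p a); rewrite -?p_sg mem_p.
Qed.

End MiddleMap.
End MiddleRoots.

Section MaximalRoots.
Variables n k : nat.
Hypothesis kn : k.+1 = n.
Implicit Types (a b c d : lab n) (A B X D : {set lab n}).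
Implicit Types (R : {set {set lab n}}).

Lemma csts_full A a : A \in csts n k -> (sg a \in A) = (a \notin A).
Proof.
move=> Ak; apply/idP/idP => [saA|aA]; first by rewrite -(sgK a) (csts_sg Ak).
apply: contraT => saA.
have [_ dis] := leq_card_setU A (sgs A).
have := disjoint_sgs Ak; rewrite -dis card_sgs (card_csts Ak) => /eqP cU.
have : A :|: sgs A \subset ~: [set a].
  apply/subsetP=> x; rewrite !inE mem_sg.
  by apply: contraTN => /eqP->; rewrite (negPf aA).
move/subset_leq_card; rewrite cardsC1 -cardsT card_lab cU -kn.
by rewrite mulnC muln2 -addnn addnS /= addSn ltnn.
Qed.

Lemma wadj_full A B : A \in csts n k -> B \in csts n k -> #|A :&: B| = k ->
  wadj k A B.
Proof.
move=> Ak Bk cAB; rewrite /wadj cAB eqxx /=.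
have /subsetPn[a aA aB] : ~~ (A \subset B).
  apply/negP=> /setIidPl AB; move: cAB; rewrite AB (card_csts Ak); lia.
by apply/exists_inP; exists a => //; rewrite (csts_full _ Bk).
Qed.

Definition cov (X : {set lab n}) : {set {set lab n}} :=
  [set A in csts n k | X \subset A].

Definition pairs : {set {set lab n}} :=
  [set X : {set lab n} | (#|X| == 2) && consistent X].

Lemma short_cov a b : rset k a b = if b == sg a then cov [set a] else cov [set a; sg b].
Proof.
apply/setP=> A; rewrite inE; case: ifPn => [/eqP->|bsa].
  rewrite [in RHS]inE sub1set; apply: andb_id2l => Ak.
  by rewrite sgK orbb andb_idr // => /(csts_sg Ak).
rewrite [in RHS]inE subUset !sub1set; apply: andb_id2l => Ak.
by rewrite !(csts_full _ Ak) negbK andbC orbb andbC.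
Qed.

Hypothesis k_gt0 : (0 < k)%N.

Lemma cov_subset X D : X \in pairs -> D \in pairs ->
  cov X \subset cov D -> X = D.
Proof.
rewrite !inE => /andP[/eqP cX consX] /andP[/eqP cD _] /subsetP sub.
apply/esym/eqP; rewrite eqEcard cX cD leqnn andbT; apply/subsetP=> a aD.
apply: contraT => aX.
have [||A [Ak XA /negP[]]] := csts_extend1 (k := k) consX aX; first by rewrite cX.
  by rewrite -kn.
have : A \in cov D by apply: sub; rewrite inE Ak.
by rewrite inE Ak => /subsetP; apply.
Qed.

Lemma pairs_rset a b : a != b -> b != sg a -> [set a; sg b] \in pairs.
Proof.
move=> ab bsa; have asb : a != sg b by rewrite -sg_eqC eq_sym.
rewrite inE cards2 asb /=.
by apply: consistent2; rewrite (inj_eq (@sg_inj n)) eq_sym.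
Qed.

Lemma minroots_max : minroots n k = [set cov X | X in pairs].
Proof.
have covr X : X \in pairs -> cov X \in rsets n k.
  rewrite inE => /andP[/cards2P[a [b [ab ->]]] /forall_inP cons].
  have bsa : b != sg a.
    apply: contraTneq (set21 a b) => bE.
    by have := cons a; rewrite !inE bE !eqxx orbT => /(_ isT).
  apply/rsetsP; exists (a, sg b) => /=.
    by rewrite -sg_eqC eq_sym.
  by rewrite short_cov (inj_eq (@sg_inj n)) eq_sym (negPf ab) sgK.
have rcov R : R \in rsets n k -> exists2 X, X \in pairs & cov X \subset R.
  case/rsetsP=> -[a b] /= ab ->; rewrite short_cov; case: ifPn => bsa; last first.
    by exists [set a; sg b]; rewrite ?pairs_rset.
  have [c] : exists c, c \notin [set a; sg a].
    apply/existsP; rewrite -[X in is_true X]negbK negb_exists.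
    apply/negP=> /forallP noc.
    have /subset_leq_card : [set: lab n] \subset [set a; sg a].
      by apply/subsetP=> c _; have := noc c; rewrite negbK.
    by rewrite card_lab cards2; case: (_ != _) => /=; lia.
  rewrite !inE negb_or => /andP[ca csa]; exists [set a; sg c].
    by apply: pairs_rset => //; rewrite eq_sym.
  by apply/subsetP=> A; rewrite !inE subUset => /andP[-> /andP[]].
apply/setP=> R; rewrite inE; apply/andP/imsetP => [[Rr /forall_inP Rmin]|[X Xp ->]].
  have [X Xp XR] := rcov R Rr; exists X => //.
  exact/esym/eqP/(implyP (Rmin _ (covr X Xp))).
split; first exact: covr.
apply/forall_inP=> R1 R1r; apply/implyP=> RX.
have [D Dp DR] := rcov R1 R1r.
have DX := cov_subset Dp Xp (subset_trans DR RX).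
by rewrite eqEsubset RX -DX.
Qed.

Lemma card_minroots2 A B : A \in csts n k -> B \in csts n k ->
  #|[set R in minroots n k | (A \in R) && (B \in R)]| = 'C(#|A :&: B|, 2).
Proof.
move=> Ak Bk; rewrite minroots_max -cards_draws.
have -> : [set R in [set cov X | X in pairs] | (A \in R) && (B \in R)] =
    [set cov X | X in [set X : {set lab n} | (X \subset A :&: B) & (#|X| == 2)]].
  apply/setP=> R; apply/setIdP/imsetP => [[/imsetP[X Xp ->]]|[X + ->]].
    rewrite ![_ \in cov _]inE Ak Bk /= => /andP[XA XB]; exists X => //.
    by rewrite inE subsetI XA XB; move: Xp; rewrite inE => /andP[].
  rewrite inE subsetI => /andP[/andP[XA XB] cX]; split; last first.
    by rewrite ![_ \in cov _]inE Ak Bk XA XB.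
  apply: imset_f; rewrite inE cX /=; apply/forall_inP=> a aX.
  by apply: contraNN (csts_sg Ak (subsetP XA _ aX)) => /(subsetP XA).
rewrite card_in_imset // => X D.
have toP Y : Y \in [set X : {set lab n} | (X \subset A :&: B) & (#|X| == 2)] ->
    Y \in pairs.
  rewrite !inE subsetI => /andP[/andP[YA _] ->]; apply/forall_inP=> a aY.
  by apply: contraNN (csts_sg Ak (subsetP YA _ aY)) => /(subsetP YA).
by move=> /toP Xp /toP Dp E; apply: cov_subset => //; rewrite E.
Qed.

Section MaximalMap.
Variable phi : {set lab n} -> {set lab n}.
Hypothesis phi_csts : {in csts n k, forall A, phi A \in csts n k}.
Hypothesis phi_inj : {in csts n k &, injective phi}.

Lemma wadj_max A B : (1 < k)%N ->
    (forall R, R \in rsets n k ->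
       exists2 R', R' \in rsets n k & R' \subset phi @: R) ->
    A \in csts n k -> B \in csts n k -> wadj k A B ->
  wadj k (phi A) (phi B).
Proof.
move=> k_gt1 phi_rsets Ak Bk /andP[/eqP cAB _]; apply: wadj_full; rewrite ?phi_csts //.
have minsub R : R \in minroots n k -> R \subset csts n k.
  by rewrite inE => /andP[/rsets_sub].
have : 'C(#|phi A :&: phi B|, 2) = 'C(k, 2).
  rewrite -cAB -!card_minroots2 ?phi_csts //.
  rewrite -{1}(phi_minrootsE phi_csts phi_inj phi_rsets).
  rewrite -[RHS](@card_in_imset _ _ (fun R : {set {set lab n}} => phi @: R));
    last first.
    move=> R1 R2 /setIdP[/minsub R1k _] /setIdP[/minsub R2k _].
    by apply: (phi_imset_inj phi_inj); rewrite inE.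
  congr #|pred_of_set _|; apply/setP=> R.
  apply/setIdP/imsetP => [[/imsetP[R1 R1m ->]]|[R1 /setIdP[R1m] + ->]].
    rewrite !(mem_phi phi_inj) ?minsub // => AB.
    by exists R1 => //; apply/setIdP.
  by move=> AB; rewrite !(mem_phi phi_inj) ?minsub // imset_f.
have lt_bin i j : (i < j)%N -> (1 < j)%N -> ('C(i, 2) < 'C(j, 2))%N.
  case: j => // j; rewrite ltnS binS bin1 => ij j1.
  by have := leq_bin2l 2 ij; lia.
move: #|_ :&: _| => m E; case: (ltngtP m k) => // mk.
  by have := lt_bin _ _ mk k_gt1; lia.
by have := lt_bin _ _ mk (ltn_trans k_gt1 mk); lia.
Qed.

Lemma wadj_quadrangle A B : k = 1%N ->
    {in csts n k, forall C, phi (sgs C) = sgs (phi C)} ->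
    A \in csts n k -> B \in csts n k -> wadj k A B ->
  wadj k (phi A) (phi B).
Proof.
move=> k1 phi_sg Ak Bk /andP[/eqP cAB _]; apply: wadj_full; rewrite ?phi_csts //.
have sgsk := sgs_csts Ak.
have lt : (#|phi A :&: phi B| <= k)%N.
  rewrite -ltnS -(card_csts (phi_csts Ak)) ltn_neqAle.
  rewrite subset_leq_card ?subsetIl // andbT.
  apply/eqP=> cE; have AB : phi A \subset phi B.
    by apply/setIidPl/eqP; rewrite eqEcard subsetIl cE /=.
  have : phi A = phi B.
    apply/eqP; rewrite eqEcard AB (card_csts (phi_csts Ak)).
    by rewrite (card_csts (phi_csts Bk)) leqnn.
  by move/(phi_inj Ak Bk) => E; rewrite E setIid (card_csts Bk) in cAB; lia.
have gt : (0 < #|phi A :&: phi B|)%N.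
  rewrite card_gt0; apply/eqP=> I0.
  have : phi B = phi (sgs A).
    rewrite phi_sg //; apply/eqP; rewrite eqEcard card_sgs.
    rewrite (card_csts (phi_csts Ak)) (card_csts (phi_csts Bk)) leqnn andbT.
    apply/subsetP=> b bB; rewrite mem_sg csts_full ?phi_csts //.
    by apply/negP=> bA; have := in_set0 b; rewrite -I0 inE bA bB.
  move/(phi_inj Bk sgsk)=> E.
  have /set0Pn[x] : A :&: B != set0 by rewrite -card_gt0 cAB k1.
  rewrite E inE mem_sg => /andP[xA]; exact/negP/(csts_sg Ak).
lia.
Qed.

End MaximalMap.
End MaximalRoots.

Lemma wadj_points n (phi : {set lab n} -> {set lab n}) A B :
    {in csts n 0, forall C, phi (sgs C) = sgs (phi C)} ->
    {in csts n 0, forall A, phi A \in csts n 0} ->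
    A \in csts n 0 -> B \in csts n 0 -> wadj 0 A B ->
  wadj 0 (phi A) (phi B).
Proof.
move=> phi_sg phi_csts Ak Bk /andP[_ /exists_inP[a aA saB]].
have /cards1P[a' AE] : #|A| == 1%N by rewrite (card_csts Ak).
have /cards1P[b' BE] : #|B| == 1%N by rewrite (card_csts Bk).
have /cards1P[c cE] : #|phi A| == 1%N by rewrite (card_csts (phi_csts A Ak)).
have -> : B = sgs A.
  rewrite AE inE in aA; rewrite BE inE in saB; rewrite AE BE /sgs imset_set1.
  by rewrite -(eqP saB) (eqP aA).
rewrite phi_sg // cE /sgs imset_set1; apply/andP; split.
  rewrite cards_eq0; apply/eqP/setP=> x; rewrite !inE.
  by apply/negP=> /andP[/eqP->]; rewrite eq_sym sg_neq.
by apply/exists_inP; exists c; rewrite inE.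
Qed.

Section FrameGeometry.
Variables (F : fieldType) (V : vectType F) (Om : {skew_symmetric V}).
Hypothesis sympl : is_psymplectic Om.
Variables n k : nat.
Hypothesis dimV : \dim {:V} = (2 * n)%N.
Implicit Types (u v w x y : V) (U W S T : {vspace V}).
Implicit Types (a b c : lab n) (A B X D : {set lab n}) (e d : lab n -> V).

Definition grass U := (\dim U == k.+1) && isotropic Om U.

Definition weyl S U := (\dim (S :&: U) == k) && ~~ (S <= orthov Om U)%VS.

Definition antipodal S U := (S :&: orthov Om U == 0)%VS.

Lemma orthov_cspan e A : frame Om e ->
  orthov Om (cspan e A) = cspan e (~: sgs A).
Proof.
move=> fe; apply/vspaceP=> v; apply/idP/idP => [/mem_orthovP vA|].
  by apply/(cspanC dimV fe) => u uA; apply: formC0; apply: vA.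
by move/(cspanC dimV fe)=> vA; apply/mem_orthovP=> u uA; apply: formC0; apply: vA.
Qed.

Lemma cspan_orthov e A B : frame Om e ->
  (cspan e A <= orthov Om (cspan e B))%VS = (A \subset ~: sgs B).
Proof. by move=> fe; rewrite orthov_cspan // (cspan_sub dimV fe). Qed.

Lemma grass_cspan e A : frame Om e -> grass (cspan e A) = (A \in csts n k).
Proof.
move=> fe; rewrite /grass (dim_cspan fe) inE /isotropic cspan_orthov //.
congr (_ && _); apply/subsetP/forall_inP => sub a aA.
  by have := sub a aA; rewrite inE mem_sg.
by rewrite inE mem_sg sub.
Qed.

Lemma weyl_cspan e A B : frame Om e -> weyl (cspan e A) (cspan e B) = wadj k A B.
Proof.
move=> fe; rewrite /weyl -(cspanI dimV fe) (dim_cspan fe) cspan_orthov //.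
congr (_ && _); apply/subsetPn/exists_inP => -[a aA].
  by rewrite inE negbK mem_sg; exists a.
by move=> saB; exists a => //; rewrite inE negbK mem_sg.
Qed.

Lemma antipodal_cspan e A B : frame Om e -> A \in csts n k -> B \in csts n k ->
  antipodal (cspan e A) (cspan e B) = (A == sgs B).
Proof.
move=> fe Ak Bk; rewrite /antipodal orthov_cspan // -(cspanI dimV fe).
rewrite -dimv_eq0 (dim_cspan fe) cards_eq0 -setDE setD_eq0 eqEcard card_sgs.
by rewrite (card_csts Ak) (card_csts Bk) leqnn andbT.
Qed.

Lemma grass_common_frame S U : grass S -> grass U ->
  exists e A B, [/\ frame Om e, A \in csts n k, B \in csts n k,
    S = cspan e A & U = cspan e B].
Proof.
move=> Sg Ug; have [/andP[_ isoS] /andP[_ isoU]] := (Sg, Ug).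
have [e [A [B [fe SE UE]]]] := common_frame sympl dimV isoS isoU.
by exists e, A, B; rewrite -!(grass_cspan _ fe) -SE -UE.
Qed.

Definition rmove e a b : lab n -> V := fun x : lab n =>
  if x == a then e a + e b
  else if x == sg b
  then e (sg b) - (Om (e b) (e (sg b)) / Om (e a) (e (sg a))) *: e (sg a)
  else e x.

Lemma rmove_frame e a b : frame Om e -> a != b -> frame Om (rmove e a b).
Proof.
move=> fe ab.
suff rE (x y : lab n) : Om (rmove e a b x) (rmove e a b y) = Om (e x) (e y).
  by move=> x y; rewrite rE fe.
have f0 := frame0 fe; have sgKn := @sgK n; rewrite /involutive /cancel in sgKn.
have asa : a <> sg a by move/eqP; rewrite eq_sym sg_neq.
have saa : sg a <> a by move/eqP; rewrite sg_neq.
have bsb : b <> sg b by move/eqP; rewrite eq_sym sg_neq.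
have sbb : sg b <> b by move/eqP; rewrite sg_neq.
move/eqP in ab.
have main (z : lab n) : Om (rmove e a b a) (rmove e a b z) = Om (e a) (e z).
  rewrite {1}/rmove eqxx /rmove; case: eqP => [->|za].
    by rewrite (formxx sympl) (formxx sympl).
  case: eqP => [zE|zb]; last first.
    by rewrite linearDl /= (f0 b z) ?addr0 //; apply/eqP; congruence.
  have h1 : Om (e a) (e (sg b)) = 0 by apply/f0/eqP; congruence.
  have h2 : Om (e b) (e (sg a)) = 0 by apply/f0/eqP; congruence.
  have h3 : Om (e a) (e (sg a)) != 0 by rewrite fe.
  rewrite zE linearDl /= !linearBr /= !linearZr_LR /= h1 h2 mulr0 subr0 sub0r.
  by rewrite divfK // addNr.
have [->|/eqP xa] := eqVneq x a; first exact: main.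
have [->|/eqP ya] := eqVneq y a.
  by rewrite form_swap main form_swap opprK.
rewrite /rmove; case: (x =P a) => // _; case: (y =P a) => // _.
have aux (z : lab n) : z <> a -> Om (e (sg a)) (e z) = 0.
  by move=> za; apply/f0/eqP; rewrite sgK.
case: (x =P sg b) => [xE|xb]; case: (y =P sg b) => [yE|yb] //.
- by rewrite xE yE !(formxx sympl).
- by rewrite linearBl /= linearZl_LR /= aux // mulr0 subr0 xE.
- by rewrite linearBr /= linearZr_LR /= (formC0 (aux _ xa)) mulr0 subr0 yE.
Qed.

Lemma rmove_cspan e a b A : frame Om e -> a != b -> A \in csts n k ->
  A \notin rset k a b -> cspan (rmove e a b) A = cspan e A.
Proof.
move=> fe ab Ak; rewrite inE Ak /= negb_or !negb_and !negbK => /andP[aA bA].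
have fd := rmove_frame fe ab.
apply/eqP; rewrite eqEdim (dim_cspan fe) (dim_cspan fd) leqnn andbT.
apply/subv_sumP=> x xA; rewrite -memvE /rmove; case: eqP => [xa|_].
  by rewrite xa in xA; rewrite xA in aA; rewrite memvD ?(frame_mem dimV fe).
case: eqP => [xb|_]; last by rewrite (frame_mem dimV fe).
rewrite xb in xA; rewrite xA in bA.
by rewrite memvB ?memvZ ?(frame_mem dimV fe).
Qed.

Lemma rmove_new e a b A B : frame Om e -> a != b -> a \in A -> b \notin A ->
  cspan e A <> cspan (rmove e a b) B.
Proof.
move=> fe ab aA bA E; have fd := rmove_frame fe ab.
have da : rmove e a b a = e a + e b by rewrite /rmove eqxx.
have db : rmove e a b b = e b.
  by rewrite /rmove eq_sym (negPf ab) eq_sym sg_neq.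
have eaB : rmove e a b a - rmove e a b b \in cspan (rmove e a b) B.
  by rewrite da db addrK -E (frame_mem dimV fe).
have bB : b \in B.
  apply: contraT => bB; have /(cspanP dimV fd) := eaB => /(_ b bB) /eqP.
  rewrite linearBr /= (frame0 fd (a := sg b)) ?sgK // sub0r oppr_eq0.
  by rewrite (negPf (frame_sg fd b)).
by move: bA; rewrite -(frame_mem dimV fe) E -db (frame_mem dimV fd) bB.
Qed.

Lemma frame_separate e d (X : {set {set lab n}}) : frame Om e -> frame Om d ->
    (forall A, A \in X -> exists B, cspan e A = cspan d B) ->
    (forall a b, a != b -> exists2 A, A \in X & A \in rset k a b) ->
  forall A, exists B, cspan e A = cspan d B.
Proof.
move=> fe fd common sep.
pose good A := [exists B, cspan e A == cspan d B].
have goodP A : reflect (exists B, cspan e A = cspan d B) (good A).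
  by apply: (iffP existsP) => -[B /eqP]; exists B => //; apply/eqP.
have good_orth A : good A -> good (~: sgs A).
  by case/goodP=> B E; apply/goodP; exists (~: sgs B); rewrite -!orthov_cspan // E.
have goodI A B : good A -> good B -> good (A :&: B).
  move=> /goodP[A' EA] /goodP[B' EB]; apply/goodP; exists (A' :&: B').
  by rewrite (cspanI dimV fe) (cspanI dimV fd) EA EB.
have goodT : good [set: lab n].
  by apply/goodP; exists setT; rewrite (cspanT dimV fe) (cspanT dimV fd).
have goodU A B : good A -> good B -> good (A :|: B).
  move=> /goodP[A' EA] /goodP[B' EB]; apply/goodP; exists (A' :|: B').
  by rewrite !cspanU EA EB.
have good0 : good set0 by apply/goodP; exists set0; rewrite !cspan0.
have good1 a : good [set a].
  pose Y := \bigcap_(A : {set lab n} | good A && (a \in A)) A.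
  have -> : [set a] = Y.
    apply/setP=> c; rewrite inE; apply/eqP/bigcapP => [-> A /andP[]//|cY].
    apply/esym/eqP; apply: contraT => ac.
    have [A AX] := sep a c ac; rewrite inE => /andP[_ /orP[/andP[aA cA]|/andP[sc sa]]].
      by have := cY A; rewrite aA andbT (negPf cA) => -> //; apply/goodP/common.
    have gA : good (~: sgs A) by apply/good_orth/goodP/common.
    by have := cY (~: sgs A); rewrite gA !inE !mem_sg sc sa => /(_ isT).
  by rewrite /Y; apply: (big_ind good) => // A /andP[].
move=> A; apply/goodP; rewrite -[A]set_enum.
have -> : [set x in enum A] = \bigcup_(a in A) [set a].
  apply/setP=> x; rewrite inE mem_enum.
  by apply/idP/bigcupP => [xA|[y yA /set1P->]//]; exists x; rewrite ?inE.
by apply: (big_ind good).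
Qed.

End FrameGeometry.

Section Matchings.
Variables (T : eqType) (D : {pred T}).

Definition matching (r : rel T) :=
  [/\ {in D, forall x, exists2 y, y \in D & r x y}, {in D &, symmetric r},
      {in D, irreflexive r}
    & {in D & &, forall x y z, r x y -> r x z -> y = z}].

(* [r1], [r2], [r3] live on the sets [R + {s, u}], [R + {q, u}] and [R + {s, q}];
   on the domain [D] of the labels, [q] is called [s] in [r2] and [u] in [r3]. *)
Lemma three_matchings (r1 r2 r3 : rel T) s u :
    matching r1 -> matching r2 -> matching r3 -> s \in D -> u \in D -> s != u ->
    let R := [pred x in D | (x != s) && (x != u)] in
    {in R &, r1 =2 r2} -> {in R &, r1 =2 r3} -> {in R, r1 s =1 r3 s} ->
    {in R, r1 u =1 r2 u} -> {in R, r2 s =1 r3 u} ->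
  r1 s u.
Proof.
move=> [ex1 sym1 irr1 uni1] [ex2 sym2 irr2 uni2] [ex3 sym3 irr3 uni3] sD uD su R.
move=> r12 r13 r13s r12u r23.
have [v vD sv] := ex1 s sD; have [<-//|vu] := eqVneq v u.
have vs : v != s by apply: contraTneq sv => ->; rewrite irr1.
have vR : v \in R by rewrite inE vD vs vu.
have [z zD uz] := ex3 u uD.
have zu : z != u by apply: contraTneq uz => ->; rewrite irr3.
have sv3 : r3 s v by rewrite -r13s.
have zs : z != s.
  apply: contraNneq vu => zs; rewrite zs sym3 // in uz.
  by rewrite (uni3 s u v).
have zR : z \in R by rewrite inE zD zs zu.
have zv : z != v.
  apply: contraNneq su => zv; rewrite zv sym3 // in uz; rewrite sym3 // in sv3.
  by rewrite (uni3 v s u).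
have sz2 : r2 s z by rewrite r23.
have [y yD zy] := ex1 z zD.
have yz : y != z by apply: contraTneq zy => ->; rewrite irr1.
have ys : y != s.
  apply: contraNneq zv => ys; rewrite ys sym1 // in zy.
  by rewrite (uni1 s z v).
have yu : y != u.
  apply: contraNneq su => yu; rewrite yu sym1 // r12u // sym2 // in zy.
  by rewrite sym2 // in sz2; rewrite (uni2 z s u).
have yR : y \in R by rewrite inE yD ys yu.
rewrite r12 // in zy; rewrite sym2 // in sz2.
by rewrite (uni2 z y s) ?eqxx in ys.
Qed.

End Matchings.

Section BaseMaps.
Variables (F F' : fieldType) (V : vectType F) (V' : vectType F').
Variables (Om : {skew_symmetric V}) (Om' : {skew_symmetric V'}).
Hypothesis sympl : is_psymplectic Om.
Variable n : nat.
Hypotheses (dimV : \dim {:V} = (2 * n)%N) (dimV' : \dim {:V'} = (2 * n)%N).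
Implicit Types (S U T : {vspace V}) (e d : lab n -> V).
Implicit Types (a b c : lab n) (A B X D : {set lab n}).

Definition base_map k (g : {vspace V} -> {vspace V'}) :=
  forall e, frame Om e -> exists e' : lab n -> V', [/\ frame Om' e',
    {in csts n k, forall A, exists2 B, B \in csts n k & g (cspan e A) = cspan e' B}
  & {in csts n k, forall B, exists2 A, A \in csts n k & g (cspan e A) = cspan e' B}].

Definition induces k (g : {vspace V} -> {vspace V'}) e (e' : lab n -> V')
    (phi : {set lab n} -> {set lab n}) :=
  [/\ frame Om' e', {in csts n k, forall A, g (cspan e A) = cspan e' (phi A)},
      {in csts n k, forall A, phi A \in csts n k} & {in csts n k &, injective phi}].

Section OneMap.
Variables (k : nat) (g : {vspace V} -> {vspace V'}).
Hypothesis gP : base_map k g.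

Lemma base_map_induces e : frame Om e ->
  exists (e' : lab n -> V') phi, induces k g e e' phi.
Proof.
move=> fe; have [e' [fe' to onto]] := gP fe; exists e'.
have [phi phiP] : {phi & forall A, A \in csts n k ->
    phi A \in csts n k /\ g (cspan e A) = cspan e' (phi A)}.
  apply: (choice (P := fun A B => A \in csts n k ->
    B \in csts n k /\ g (cspan e A) = cspan e' B)) => A.
  have [Ak|Ak] := boolP (A \in csts n k); last by exists A.
  by have [B Bk E] := to A Ak; exists B.
have phik : {in csts n k, forall A, phi A \in csts n k} by move=> A /phiP[].
exists phi; split=> //; first by move=> A /phiP[].
apply/imset_injP; rewrite eqn_leq leq_imset_card subset_leq_card //.
apply/subsetP=> B Bk; have [A Ak E] := onto B Bk; apply/imsetP; exists A => //.
by apply: (cspan_inj dimV' fe'); have [_ <-] := phiP A Ak.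
Qed.

Lemma base_map_inj S U : grass Om k S -> grass Om k U -> g S = g U -> S = U.
Proof.
move=> Sg Ug; have [e [A [B [fe Ak Bk -> ->]]]] := grass_common_frame sympl dimV Sg Ug.
have [e' [phi [fe' gE phik phi_inj]]] := base_map_induces fe.
by rewrite !gE // => /(cspan_inj dimV' fe') /phi_inj ->.
Qed.

Section OneFrameMap.
Variables (e : lab n -> V) (e' : lab n -> V') (phi : {set lab n} -> {set lab n}).
Hypotheses (fe : frame Om e) (ind : induces k g e e' phi).

Lemma induces_rsets R : (k < n)%N -> R \in rsets n k ->
  exists2 R', R' \in rsets n k & R' \subset phi @: R.
Proof.
move=> kn /rsetsP[[a b] /= ab RE]; have [fe' gE phik phi_inj] := ind.
apply/exists_inP; rewrite -[X in is_true X]negbK negb_exists_in.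
apply/negP=> /forall_inP none.
have fd := rmove_frame sympl fe ab.
have [d' [psi [fd' gdE psik psi_inj]]] := base_map_induces fd.
have common A : A \in csts n k :\: phi @: R -> exists B, cspan e' A = cspan d' B.
  rewrite inE -{1}(inj_csts phik phi_inj) => /andP[AR /imsetP[B Bk AE]].
  have BR : B \notin rset k a b by apply: contraNN AR => BR; rewrite AE RE imset_f.
  by exists (psi B); rewrite AE -gE // -gdE // (rmove_cspan sympl dimV fe ab Bk BR).
have sep c1 c2 : c1 != c2 ->
    exists2 A, A \in csts n k :\: phi @: R & A \in rset k c1 c2.
  move=> /(mem_rsets k) /none /subsetPn[A Ar AR]; exists A => //.
  by rewrite inE AR (subsetP (rset_sub _ _ _) _ Ar).
have [A [Ak]] : exists A, [/\ A \in csts n k, [set a] \subset A & b \notin A].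
  by apply: csts_extend1; rewrite ?consistent1 ?cards1 // inE eq_sym.
rewrite sub1set => aA bA.
have [B EB] := frame_separate dimV' fe' fd' common sep (phi A).
have Bk : B \in csts n k.
  by rewrite -(grass_cspan k dimV' B fd') -EB (grass_cspan k dimV' _ fe') phik.
move: Bk; rewrite -{1}(inj_csts psik psi_inj) => /imsetP[C Ck BE].
apply: (rmove_new sympl dimV fe ab aA bA (B := C)); apply: base_map_inj.
- by rewrite grass_cspan.
- by rewrite grass_cspan.
by rewrite gE // gdE // EB BE.
Qed.

End OneFrameMap.

Lemma induces_matching d (d' : lab n -> V') psi : induces k g d d' psi ->
  matching (csts n k) (fun A B => antipodal Om' (g (cspan d A)) (g (cspan d B))).
Proof.
case=> fd' gE psik psi_inj.
have oE : {in csts n k &, forall A B,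
    antipodal Om' (g (cspan d A)) (g (cspan d B)) = (psi A == sgs (psi B))}.
  move=> A B Ak Bk; rewrite !gE //.
  by rewrite (antipodal_cspan dimV' fd' (psik A Ak) (psik B Bk)).
split=> [A Ak|A B Ak Bk|A Ak|A B C Ak Bk Ck].
- have := sgs_csts (psik A Ak); rewrite -{1}(inj_csts psik psi_inj) => /imsetP[B Bk BE].
  by exists B; rewrite // oE // -BE sgsK.
- by rewrite !oE // eq_sym (can2_eq (@sgsK n) (@sgsK n)).
- rewrite oE //; have /card_gt0P[a aA] : (0 < #|psi A|)%N.
    by rewrite (card_csts (psik A Ak)).
  apply/eqP=> AE; have := csts_sg (psik A Ak) aA.
  by rewrite AE mem_sg sgK aA.
rewrite !oE // => /eqP-> /eqP/(can_inj (@sgsK n)); exact: psi_inj.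
Qed.

(* [rset k a b] and [rset k b a] being singletons, the two root moves replace
   just one of the two spaces, and both put the same space in its place. *)
Lemma induces_opp e (e' : lab n -> V') phi a b : frame Om e -> induces k g e e' phi ->
    a != b -> let C := [set a; sg b] in C \in csts n k ->
    {in rset k a b, forall A, A = C} -> {in rset k b a, forall A, A = sgs C} ->
  phi (sgs C) = sgs (phi C).
Proof.
move=> fe ind ab C Ck abC baC; have ba : b != a by rewrite eq_sym.
have fd := rmove_frame sympl fe ab; have fd3 := rmove_frame sympl fe ba.
set d := rmove Om e a b in fd *; set d3 := rmove Om e b a in fd3 *.
have [d' [psi ind2]] := base_map_induces fd.
have [d3' [psi3 ind3]] := base_map_induces fd3.
have C'k := sgs_csts Ck.
have CC' : C != sgs C.
  have aC : a \in C by rewrite set21.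
  by apply/eqP=> E; have := csts_sg Ck aC; rewrite E mem_sg sgK aC.
have dE A : A \in csts n k -> A != C -> cspan d A = cspan e A.
  move=> Ak AC; apply: (rmove_cspan (k := k) sympl dimV) => //.
  by apply: contraNN AC => /abC->.
have d3E A : A \in csts n k -> A != sgs C -> cspan d3 A = cspan e A.
  move=> Ak AC; apply: (rmove_cspan (k := k) sympl dimV) => //.
  by apply: contraNN AC => /baC->.
have qE : cspan d C = cspan d3 (sgs C).
  have CE : sgs C = [set sg a; b].
    by rewrite sgs2 sgK.
  have da : d a = e a + e b by rewrite /d /rmove eqxx.
  have d3b : d3 b = e a + e b by rewrite /d3 /rmove eqxx addrC.
  rewrite CE !cspanU !cspan1 da d3b addvC; congr (_ + _)%VS.
  have [E|sba] := eqVneq (sg b) a.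
    have E' : sg a = b by rewrite -E sgK.
    by rewrite E E' da d3b.
  have sab : sg a != b by rewrite sg_eqC eq_sym.
  rewrite /d /rmove (negPf sba) eqxx /d3 /rmove (negPf sab) eqxx.
  have x0 : Om (e b) (e (sg b)) != 0 by rewrite fe.
  have y0 : Om (e a) (e (sg a)) != 0 by rewrite fe.
  set x := Om (e b) _ in x0 *; set y := Om (e a) _ in y0 *.
  rewrite -(@vline_scale _ _ (- (y / x))) ?oppr_eq0 ?mulf_neq0 ?invr_eq0 //.
  rewrite scalerBr scalerA mulNr !scaleNr opprK mulrA divfK // divff //.
  by rewrite scale1r addrC.
have := three_matchings (induces_matching ind) (induces_matching ind2)
  (induces_matching ind3) Ck C'k CC'.
case: ind => fe' gE phik phi_inj.
move=> /= main; have : antipodal Om' (g (cspan e C)) (g (cspan e (sgs C))).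
  apply: main => [A B|A B|A|A|A] /=.
  - by move=> /and3P[Ak AC _] /and3P[Bk BC _]; rewrite !dE.
  - by move=> /and3P[Ak _ AC] /and3P[Bk _ BC]; rewrite !d3E.
  - by move=> /and3P[Ak AC AC']; rewrite !d3E.
  - by move=> /and3P[Ak AC AC']; rewrite !dE // eq_sym.
  by move=> /and3P[Ak AC AC']; rewrite qE (dE A) ?(d3E A).
rewrite !gE // (antipodal_cspan dimV' fe' (phik _ Ck) (phik _ C'k)) => /eqP->.
by rewrite sgsK.
Qed.
End OneMap.
End BaseMaps.

Section WeylMaps.
Variables (F F' : fieldType) (V : vectType F) (V' : vectType F').
Variables (Om : {skew_symmetric V}) (Om' : {skew_symmetric V'}).
Hypothesis sympl : is_psymplectic Om.
Variable n : nat.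
Hypotheses (dimV : \dim {:V} = (2 * n)%N) (dimV' : \dim {:V'} = (2 * n)%N).
Implicit Types (S U T : {vspace V}) (e d : lab n -> V).
Implicit Types (a b c : lab n) (A B X D : {set lab n}).

Lemma base_map_grass k g S : base_map Om Om' n k g -> grass Om k S -> grass Om' k (g S).
Proof.
move=> gP Sg; have [e [A [_ [fe Ak _ -> _]]]] := grass_common_frame sympl dimV Sg Sg.
have [e' [fe' to _]] := gP e fe; have [B Bk ->] := to A Ak.
by rewrite grass_cspan.
Qed.

Lemma induces_wadj k g e (e' : lab n -> V') phi A B : (k < n)%N ->
    base_map Om Om' n k g -> frame Om e -> induces Om' k g e e' phi ->
    A \in csts n k -> B \in csts n k -> wadj k A B ->
  wadj k (phi A) (phi B).
Proof.
move=> kn gP fe ind Ak Bk AB; have [fe' gE phik phi_inj] := ind.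
have rs R : R \in rsets n k -> exists2 R', R' \in rsets n k & R' \subset phi @: R.
  exact: (induces_rsets sympl dimV dimV' gP fe ind kn).
have [k0|k_gt0] := posnP k.
  rewrite {}k0 in gP ind Ak Bk AB phik *; apply: wadj_points => // C Ck.
  have /cards1P[a CE] : #|C| == 1%N by rewrite (card_csts Ck).
  have asa x : x != sg x :> lab n by rewrite eq_sym sg_neq.
  have CE2 : C = [set a; sg (sg a)] by rewrite sgK setUid.
  rewrite CE2; apply: (induces_opp sympl dimV dimV' gP fe ind (asa a)).
  - by rewrite -CE2.
  - move=> D Da; have Dk := subsetP (rset_sub _ _ _) _ Da.
    rewrite long_rsetE // in Da; apply/esym/eqP; rewrite -CE2 eqEcard CE sub1set Da.
    by rewrite (card_csts Dk) cards1.
  move=> D; rewrite -{2}[a]sgK => Da; have Dk := subsetP (rset_sub _ _ _) _ Da.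
  rewrite long_rsetE // in Da; apply/esym/eqP; rewrite -CE2 CE eqEcard card_sgs.
  by rewrite /sgs imset_set1 sub1set Da (card_csts Dk) cards1.
have [kn1|/eqP kn1] := eqVneq k.+1 n; last first.
  by apply: wadj_middle => //; lia.
have [k1|/eqP k1] := eqVneq k 1%N; last first.
  by apply: wadj_max => //; lia.
apply: wadj_quadrangle => // C Ck.
have /cards2P[x [y [xy CE]]] : #|C| == 2 by rewrite (card_csts Ck) k1.
have ysx : y != sg x.
  have := csts_sg Ck (a := x); rewrite CE set21 => /(_ isT).
  by apply: contraNneq => <-; rewrite set22.
have CE2 : C = [set x; sg (sg y)] by rewrite sgK.
have xsy : x != sg y by rewrite -sg_eqC eq_sym.
have cov2 D x1 y1 : x1 != y1 -> D \in cov k [set x1; y1] -> D = [set x1; y1].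
  move=> xy1; rewrite inE => /andP[Dk sub]; apply/esym/eqP.
  by rewrite eqEcard sub (card_csts Dk) cards2 xy1 k1.
rewrite CE2; apply: (induces_opp sympl dimV dimV' gP fe ind xsy).
- by rewrite -CE2.
- move=> D; rewrite short_cov // (inj_eq (@sg_inj n)) eq_sym (negPf xy) sgK.
  exact: cov2.
move=> D; rewrite short_cov // sgK (negPf xy) => DC.
by rewrite sgs2 setUC; apply: cov2 DC; rewrite (inj_eq (@sg_inj n)) eq_sym.
Qed.

Lemma base_map_weyl k g S U : (k < n)%N -> base_map Om Om' n k g ->
  grass Om k S -> grass Om k U -> weyl Om k S U -> weyl Om' k (g S) (g U).
Proof.
move=> kn gP Sg Ug.
have [e [A [B [fe Ak Bk -> ->]]]] := grass_common_frame sympl dimV Sg Ug.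
have [e' [phi ind]] := base_map_induces dimV' gP fe.
have [fe' gE phik phi_inj] := ind.
rewrite weyl_cspan // !gE // weyl_cspan //.
exact: induces_wadj ind Ak Bk.
Qed.

End WeylMaps.

Section WeylTriangle.
Variables (F : fieldType) (V : vectType F) (Om : {skew_symmetric V}).
Implicit Types (S U W X Y Q : {vspace V}).

Lemma isotropic_orthov W X Y : isotropic Om W -> (X <= W)%VS -> (Y <= W)%VS ->
  (X <= orthov Om Y)%VS.
Proof.
move=> /orthovP isoW /subvP XW /subvP YW; apply/orthovP=> x y xX yY.
by apply: isoW; [apply: XW|apply: YW].
Qed.

Lemma add_hyperplanes k S X Y : \dim S = k.+1 -> \dim X = k -> \dim Y = k ->
  (X <= S)%VS -> (Y <= S)%VS -> ~~ (X <= Y)%VS -> S = (X + Y)%VS.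
Proof.
move=> dS dX dY XS YS XY; apply/esym/eqP; rewrite eqEdim subv_add XS YS dS /=.
rewrite ltnNge; apply: contra XY => le.
have := dimv_leqif_eq (addvSr X Y); rewrite dY => -[_].
rewrite eqn_leq le andbT -dY dimvS ?addvSr // => /esym/eqP ->.
exact: addvSl.
Qed.

Lemma weyl_triangle k S U Q : grass Om k S -> grass Om k U -> grass Om k Q ->
    weyl Om k S U -> weyl Om k S Q -> weyl Om k U Q ->
  (S :&: U <= Q)%VS.
Proof.
move=> /andP[/eqP dS isoS] /andP[/eqP dU isoU] /andP[_ isoQ].
move=> /andP[/eqP dSU SU] /andP[/eqP dSQ _] /andP[/eqP dUQ _].
apply: contraNT SU => TQ.
have notin X : ~~ (S :&: U <= X :&: Q)%VS.
  by apply: contraNN TQ => /subv_trans; apply; apply: capvSr.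
have SE := add_hyperplanes dS dSU dSQ (capvSl _ _) (capvSl _ _) (notin S).
have UE := add_hyperplanes dU dSU dUQ (capvSr _ _) (capvSl _ _) (notin U).
have o1 : (S :&: U <= orthov Om (S :&: U))%VS.
  exact: isotropic_orthov isoS (capvSl _ _) (capvSl _ _).
have o2 : (S :&: U <= orthov Om (U :&: Q))%VS.
  exact: isotropic_orthov isoU (capvSr _ _) (capvSl _ _).
have o3 : (S :&: Q <= orthov Om (S :&: U))%VS.
  exact: isotropic_orthov isoS (capvSl _ _) (capvSl _ _).
have o4 : (S :&: Q <= orthov Om (U :&: Q))%VS.
  exact: isotropic_orthov isoQ (capvSr _ _) (capvSr _ _).
by rewrite SE {2}UE subv_add !orthovD o1 o2 o3 o4.
Qed.

End WeylTriangle.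

Section Reduction.
Variables (F F' : fieldType) (V : vectType F) (V' : vectType F').
Variables (Om : {skew_symmetric V}) (Om' : {skew_symmetric V'}).
Hypothesis sympl : is_psymplectic Om.
Variable n : nat.
Hypotheses (dimV : \dim {:V} = (2 * n)%N) (dimV' : \dim {:V'} = (2 * n)%N).
Variables (k : nat) (g : {vspace V} -> {vspace V'}).
Hypotheses (kn : (k.+1 < n)%N) (gP : base_map Om Om' n k.+1 g).
Implicit Types (S U T Q : {vspace V}) (x y z : V).
Implicit Types (a b c : lab n) (A B C D : {set lab n}).

Let gg S : grass Om k.+1 S -> grass Om' k.+1 (g S).
Proof. exact: (base_map_grass sympl dimV dimV' gP). Qed.

Section Star.
Variable T : {vspace V}.
Hypothesis Tg : grass Om k T.

Let st x := (T + <[x]>)%VS.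
Let adm x := (x \in orthov Om T) && (x \notin T).

Let dimT : \dim T = k.+1. Proof. by case/andP: Tg => /eqP. Qed.

Let st_grass x : adm x -> grass Om k.+1 (st x).
Proof.
case/andP=> xo xT; have /andP[_ isoT] := Tg; apply/andP; split.
  rewrite /st dimv_disjoint_sum ?dimT.
    have x0 : x != 0 by apply: contraNneq xT => ->; rewrite mem0v.
    by rewrite dim_vline x0 addn1.
  apply/eqP; rewrite -subv0; apply/subvP=> v; rewrite memv_cap => /andP[vT].
  case/vlineP=> t vE; rewrite memv0; apply: contraNT xT; rewrite vE in vT *.
  rewrite scaler_eq0 negb_or => /andP[t0 _].
  by rewrite -(scalerK t0 x) memvZ.
have oT : (T <= orthov Om T)%VS := isoT.
have xx : (<[x]> <= orthov Om <[x]>)%VS by rewrite -memvE mem_orthov1 (formxx sympl).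
have xT' : (<[x]> <= orthov Om T)%VS by rewrite -memvE.
by rewrite /isotropic /st orthovD !subv_add oT xT' xx orthov_sym xT'.
Qed.

Let adm_form x y : x \in orthov Om T -> adm y -> Om x y != 0 -> adm x.
Proof.
move=> xo /andP[/mem_orthovP yo _] xy; rewrite /adm xo; apply: contraNN xy => xT.
by rewrite (formC0 (yo x xT)).
Qed.

Let st_weyl x y : adm x -> adm y -> Om x y != 0 -> weyl Om k.+1 (st x) (st y).
Proof.
move=> ax ay xy; have /andP[/eqP dx isox] := st_grass ax.
have /andP[/eqP dy isoy] := st_grass ay.
have xS : x \in st x by apply: subvP (addvSr _ _) _ (memv_line x).
have yS : y \in st y by apply: subvP (addvSr _ _) _ (memv_line y).
apply/andP; split; last first.
  by apply: contraNN xy => /orthovP so; rewrite so.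
rewrite eqn_leq; apply/andP; split; last first.
  by rewrite -dimT dimvS // subv_cap !addvSl.
rewrite -ltnS -dx ltnNge; apply: contraNN xy => le.
have xE : (st x :&: st y)%VS = st x by apply/eqP; rewrite eqEdim capvSl.
have /orthovP iso' := isoy; rewrite iso' //.
by have := capvSr (st x) (st y); rewrite xE => /subvP; apply.
Qed.

Let img x y : (adm x /\ adm y) /\ Om x y != 0 ->
  weyl Om' k.+1 (g (st x)) (g (st y)).
Proof.
case=> -[ax ay] xy.
apply: (base_map_weyl sympl dimV dimV' kn gP) => //; last exact: st_weyl.
  exact: st_grass.
exact: st_grass.
Qed.

Let img_eq x y z : adm x -> adm y -> adm z -> Om x y != 0 -> Om x z != 0 ->
  (g (st x) :&: g (st y) <= g (st z))%VS ->
  (g (st x) :&: g (st y) = g (st x) :&: g (st z))%VS.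
Proof.
move=> ax ay az xy xz sub.
have /andP[/eqP dxy _] := img (conj (conj ax ay) xy).
have /andP[/eqP dxz _] := img (conj (conj ax az) xz).
by apply/eqP; rewrite eqEdim dxy dxz leqnn andbT subv_cap capvSl.
Qed.

Let star_clique2 x y z : adm x -> adm y -> adm z -> Om x y != 0 -> Om x z != 0 ->
  (g (st x) :&: g (st y) <= g (st z))%VS.
Proof.
move=> ax ay az xy xz.
have tri u v w : adm u -> adm v -> adm w -> Om u v != 0 -> Om u w != 0 ->
    Om v w != 0 -> (g (st u) :&: g (st v) <= g (st w))%VS.
  move=> au av aw uv uw vw; apply: (weyl_triangle (Om := Om') (k := k.+1));
    by [apply/gg/st_grass|apply/img].
have [yz|] := eqVneq (Om y z) 0; last by move=> yz; apply: tri.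
have [w [xw wP]] : exists w, [/\ Om x w != 0 &
    forall u, u \in (T + <[y]> + <[z]>)%VS -> Om w u = 0].
  apply: (separate sympl); apply: contraNN xy.
  move=> /memv_addP[u1 /memv_addP[t tT [u2 u2y ->]] [u3 u3z ->]].
  have /andP[/mem_orthovP yo _] := ay.
  rewrite form_swap linearDr /= linearDr /= yo // (form_vline u2y) ?(formxx sympl) //.
  by rewrite (form_vline u3z) // !addr0 oppr0.
have wT u : u \in T -> Om w u = 0.
  move=> uT; apply: wP; apply: subvP (addvSl _ _) _ _.
  exact: subvP (addvSl _ _) _ uT.
have wy : Om w y = 0.
  apply: wP; apply: subvP (addvSl _ _) _ _.
  exact: subvP (addvSr _ _) _ (memv_line y).
have wz : Om w z = 0 by apply: wP; apply: subvP (addvSr _ _) _ (memv_line z).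
pose r := x + w.
have xr : Om x r != 0 by rewrite /r linearDr /= (formxx sympl) add0r.
have ry : Om r y != 0 by rewrite /r linearDl /= wy addr0.
have rz : Om r z != 0 by rewrite /r linearDl /= wz addr0.
have ar : adm r.
  apply: (adm_form (y := x)) => //; last by rewrite herm_eq0C.
  by rewrite memvD //; [case/andP: ax|apply/mem_orthovP].
have yr : Om y r != 0 by rewrite herm_eq0C.
rewrite (@img_eq x y r) //; first exact: tri.
exact: tri.
Qed.

Lemma star_image : exists2 T', grass Om' k T' &
  forall S, grass Om k.+1 S -> (T <= S)%VS -> (T' <= g S)%VS.
Proof.
have /andP[_ isoT] := Tg.
have sepT x : x \notin T -> exists2 y, Om x y != 0 & y \in orthov Om T.
  by case/(separate sympl)=> y [xy yT]; exists y => //; apply/mem_orthovP.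
have [x0 ax0] : exists x, adm x.
  have /subvPn[x xo xT] : ~~ (orthov Om T <= T)%VS.
    by apply/negP=> /dimvS; have := dim_orthov sympl T; lia.
  by exists x; rewrite /adm xo.
have [y0 xy0 y0o] : exists2 y, Om x0 y != 0 & y \in orthov Om T.
  by apply: sepT; case/andP: ax0.
have ay0 : adm y0 by apply: (adm_form (y := x0)) => //; rewrite herm_eq0C.
have yx0 : Om y0 x0 != 0 by rewrite herm_eq0C.
have /andP[/eqP d0 _] := img (conj (conj ax0 ay0) xy0).
exists (g (st x0) :&: g (st y0))%VS.
  rewrite /grass d0 eqxx /=; apply: isotropicS (capvSl _ _) _.
  by case/andP: (gg (st_grass ax0)).
move=> S Sg TS; have [z zS zT] : exists2 z, z \in S & z \notin T.
  by apply/subvPn/negP=> /dimvS; have /andP[/eqP-> _] := Sg; rewrite dimT ltnn.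
have az : adm z.
  rewrite /adm zT andbT memvE (isotropic_orthov (W := S)) ?TS //.
  by case/andP: Sg.
have -> : S = st z.
  have /andP[/eqP dz _] := st_grass az; have /andP[/eqP dS _] := Sg.
  by apply/esym/eqP; rewrite eqEdim dz dS leqnn subv_add TS -memvE zS.
have [xz|xz] := eqVneq (Om x0 z) 0; last exact: star_clique2.
have [yz|yz] := eqVneq (Om y0 z) 0; last by rewrite capvC; apply: star_clique2.
have [w zw wo] := sepT z zT.
have [r [ro xr rz]] : exists r, [/\ r \in orthov Om T, Om x0 r != 0 & Om r z != 0].
  have [xw|xw] := eqVneq (Om x0 w) 0; last by exists w; split=> //; rewrite herm_eq0C.
  exists (y0 + w); rewrite memvD // linearDr /= xw addr0; split=> //.
  by rewrite linearDl /= yz add0r herm_eq0C.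
have ar : adm r by apply: adm_form rz.
have rx : Om r x0 != 0 by rewrite herm_eq0C.
rewrite (@img_eq x0 y0 r) //; last exact: star_clique2.
by rewrite capvC; apply: star_clique2.
Qed.

End Star.

Definition above A : {set {set lab n}} := [set X in csts n k.+1 | A \subset X].

Lemma card_above A : A \in csts n k -> #|above A| = (2 * n - 2 * k.+1)%N.
Proof.
move=> Ak.
have -> : above A = [set a |: A | a in ~: (A :|: sgs A)].
  apply/setP=> X; rewrite inE; apply/andP/imsetP => [[Xk AX]|[a + ->]].
    have [a aX aA] : exists2 a, a \in X & a \notin A.
      apply/subsetPn/negP=> /subset_leq_card.
      by rewrite (card_csts Ak) (card_csts Xk) ltnn.
    exists a; last first.
      apply/esym/eqP; rewrite eqEcard subUset sub1set aX AX cardsU1 aA.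
      by rewrite (card_csts Ak) (card_csts Xk) add1n leqnn.
    rewrite !inE negb_or aA mem_sg.
    by apply: contraNN (csts_sg Xk aX) => /(subsetP AX).
  rewrite !inE negb_or mem_sg => /andP[aA saA]; split; last exact: subsetUr.
  rewrite cardsU1 aA (card_csts Ak) eqxx /=; apply/forall_inP=> b.
  rewrite !inE !negb_or => /orP[/eqP->|bA]; first by rewrite sg_neq.
  rewrite (csts_sg Ak bA) andbT sg_eqC.
  by apply: contraNneq saA => <-.
rewrite card_in_imset => [|a b].
  have [_] := leq_card_setU A (sgs A).
  rewrite (disjoint_sgs Ak) card_sgs (card_csts Ak) => /eqP cU.
  by rewrite cardsCs setCK -cardsT card_lab cU addnn !mul2n.
rewrite !inE !negb_or => /andP[aA _] _ /setP/(_ a).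
by rewrite !inE eqxx (negPf aA) !orbF => /esym/eqP.
Qed.

Lemma reduce : exists2 g1, base_map Om Om' n k g1 &
  forall T S, grass Om k T -> grass Om k.+1 S -> (T <= S)%VS -> (g1 T <= g S)%VS.
Proof.
have [g1 g1P] : {g1 : {vspace V} -> {vspace V'} &
    forall T, grass Om k T -> grass Om' k (g1 T) /\
    forall S, grass Om k.+1 S -> (T <= S)%VS -> (g1 T <= g S)%VS}.
  apply: (choice (P := fun T (T' : {vspace V'}) => grass Om k T -> grass Om' k T' /\
    forall S, grass Om k.+1 S -> (T <= S)%VS -> (T' <= g S)%VS)) => T.
  have [Tg|Tg] := boolP (grass Om k T); last by exists 0%VS.
  by have [T' T'g T'P] := star_image Tg; exists T'.
exists g1; last by move=> T S /g1P[_ TP]; apply: TP.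
move=> e fe; have [e' [phi ind]] := base_map_induces dimV' gP fe.
have [fe' gE phik phi_inj] := ind; exists e'.
have sub_e B C : (cspan e B <= cspan e C)%VS = (B \subset C).
  exact: (cspan_sub dimV fe).
have to A : A \in csts n k -> exists B, B \in csts n k /\ g1 (cspan e A) = cspan e' B.
  move=> Ak; have Tg : grass Om k (cspan e A) by rewrite grass_cspan.
  have [/andP[/eqP dT' isoT'] T'P] := g1P _ Tg.
  have /card_gt0P[X] : (0 < #|above A|)%N by rewrite card_above //; lia.
  rewrite inE => /andP[Xk AX].
  have [a aX aA] : exists2 a, a \in X & a \notin A.
    apply/subsetPn/negP=> /subset_leq_card.
    by rewrite (card_csts Ak) (card_csts Xk) ltnn.
  pose Y := sg a |: A.
  have saX := csts_sg Xk aX.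
  have saA : sg a \notin A by apply: contraNN saX => /(subsetP AX).
  have Yk : Y \in csts n k.+1.
    apply/cstsP; rewrite cardsU1 saA (card_csts Ak); split=> // b.
    rewrite !inE => /orP[/eqP->|bA]; first by rewrite sgK eq_sym sg_neq (negPf aA).
    rewrite (inj_eq (@sg_inj n)) (negPf (csts_sg Ak bA)) orbF.
    by apply: contraNneq aA => <-.
  have XY : wadj k.+1 X Y.
    apply/andP; split; last first.
      by apply/exists_inP; exists a => //; apply: setU11.
    suff -> : X :&: Y = A by rewrite (card_csts Ak).
    apply/setP=> x; rewrite !inE; have [->|_] := eqVneq x (sg a).
      by rewrite (negPf saX) (negPf saA).
    by rewrite /= andb_idl // => /(subsetP AX).
  have TX : (cspan e A <= cspan e X)%VS by rewrite sub_e.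
  have TY : (cspan e A <= cspan e Y)%VS by rewrite sub_e subsetUr.
  have Xg : grass Om k.+1 (cspan e X) by rewrite grass_cspan.
  have Yg : grass Om k.+1 (cspan e Y) by rewrite grass_cspan.
  have XYw : weyl Om k.+1 (cspan e X) (cspan e Y) by rewrite weyl_cspan.
  have /andP[/eqP dI _] := base_map_weyl sympl dimV dimV' kn gP Xg Yg XYw.
  have T'E : g1 (cspan e A) = cspan e' (phi X :&: phi Y).
    rewrite (cspanI dimV' fe') -!gE //; apply/eqP.
    by rewrite eqEdim dI dT' leqnn andbT subv_cap !T'P.
  exists (phi X :&: phi Y); split=> //.
  by rewrite -(grass_cspan k dimV' _ fe') -T'E /grass dT' eqxx.
have [psi psiP] : {psi : {set lab n} -> {set lab n} & forall A, A \in csts n k ->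
    psi A \in csts n k /\ g1 (cspan e A) = cspan e' (psi A)}.
  apply: (choice (P := fun A B => A \in csts n k ->
    B \in csts n k /\ g1 (cspan e A) = cspan e' B)) => A.
  have [Ak|Ak] := boolP (A \in csts n k); last by exists A.
  by have [B BP] := to A Ak; exists B.
have aboveE A : A \in csts n k -> [set phi X | X in above A] = above (psi A).
  move=> Ak; have [psiAk psiE] := psiP A Ak.
  have abovek B X : X \in above B -> X \in csts n k.+1 by rewrite inE => /andP[].
  apply/eqP; rewrite eqEcard card_in_imset ?card_above ?leqnn ?andbT //.
    apply/subsetP=> _ /imsetP[X XA ->]; have Xk := abovek _ _ XA.
    rewrite inE phik //= -(cspan_sub dimV' fe') -psiE -gE //.
    have [_] := g1P (cspan e A) (etrans (grass_cspan k dimV A fe) Ak).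
    apply; first by rewrite grass_cspan.
    by move: XA; rewrite inE sub_e => /andP[].
  by move=> X Y /abovek Xk /abovek Yk; apply: phi_inj.
have psi_inj : {in csts n k &, injective psi}.
  have le A B : A \in csts n k -> B \in csts n k -> psi A = psi B -> B \subset A.
    move=> Ak Bk E; apply/subsetP=> b bB; apply: contraT => bA.
    have [|//|X [Xk AX bX]] := csts_extend1 (k := k.+1) (consistent_csts Ak) bA.
      by rewrite (card_csts Ak).
    have : phi X \in above (psi B) by rewrite -E -aboveE // imset_f // inE Xk.
    rewrite -aboveE // => /imsetP[Y]; rewrite inE => /andP[Yk BY] XY.
    by rewrite (phi_inj _ _ Xk Yk XY) (subsetP BY) in bX.
  by move=> A B Ak Bk E; apply/eqP; rewrite eqEsubset !le.
have psik : {in csts n k, forall A, psi A \in csts n k} by move=> A /psiP[].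
split=> [//|A /psiP[Bk E]|B Bk]; first by exists (psi A).
move: Bk; rewrite -{1}(inj_csts psik psi_inj) => /imsetP[A Ak ->]; exists A => //.
by have [] := psiP A Ak.
Qed.

End Reduction.

Lemma involution_labels m n (s : 'I_m -> 'I_m) : m = (2 * n)%N ->
    involutive s -> (forall i, s i != i) ->
  exists2 f : lab n -> 'I_m, bijective f & forall a, f (sg a) = s (f a).
Proof.
move=> mE sK sn; pose R := [set i : 'I_m | (i < s i)%N].
have RE i : (s i \in R) = (i \notin R).
  have si : (s i == i :> nat) = false by apply/negbTE/sn.
  by rewrite !inE sK -leqNgt [in RHS]leq_eqVlt si.
have cR : #|R| = n.
  have RC : ~: R = s @: R.
    apply/setP=> i; rewrite inE -RE -{2}(sK i) mem_imset //.
    exact: inv_inj sK.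
  have := cardsC R; rewrite RC card_imset ?card_ord; last exact: inv_inj sK.
  lia.
pose r (i : 'I_n) : 'I_m := enum_val (cast_ord (esym cR) i).
have rR i : r i \in R by apply: enum_valP.
have r_inj : injective r by move=> i j /enum_val_inj /cast_ord_inj.
pose f (a : lab n) := if a.2 then r a.1 else s (r a.1).
have f_inj : injective f.
  move=> [i []] [j []]; rewrite /f /=.
  - by move/r_inj->.
  - by move=> E; have := rR i; rewrite E RE rR.
  - by move=> E; have := rR j; rewrite -E RE rR.
  by move/(inv_inj sK)/r_inj->.
exists f; last by case=> i []; rewrite /f /= ?sK.
by apply: inj_card_bij => //; rewrite card_prod !card_ord card_bool mE mulnC.
Qed.

Section Points.
Variables (F F' : fieldType) (V : vectType F) (V' : vectType F').
Variables (Om : {skew_symmetric V}) (Om' : {skew_symmetric V'}).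
Hypothesis sympl : is_psymplectic Om.
Variable n : nat.
Hypotheses (dimV : \dim {:V} = (2 * n)%N) (dimV' : \dim {:V'} = (2 * n)%N).
Implicit Types (S U T P : {vspace V}).
Implicit Types (a b c : lab n) (A B C D : {set lab n}).

Lemma base_map_points k g : (k < n)%N -> base_map Om Om' n k g ->
  exists2 h, base_map Om Om' n 0 h &
    forall S P, grass Om k S -> grass Om 0 P -> (P <= S)%VS -> (h P <= g S)%VS.
Proof.
elim: k g => [|k IHk] g kn gP.
  exists g => // S P /andP[/eqP dS _] /andP[/eqP dP _] PS.
  suff -> : P = S by [].
  by apply/eqP; rewrite eqEdim PS dS dP.
have [g1 g1P sub] := reduce sympl dimV dimV' kn gP.
have [h hP hsub] := IHk g1 (ltnW kn) g1P; exists h => // S P Sg Pg PS.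
have [/andP[/eqP dS isoS] /andP[/eqP dP isoP]] := (Sg, Pg).
have [e [A [B [fe PE SE]]]] := common_frame sympl dimV isoP isoS.
rewrite PE (dim_cspan fe) in dP; rewrite SE (dim_cspan fe) in dS.
have AB : A \subset B by rewrite -(cspan_sub dimV fe) -PE -SE.
have [a aB aA] : exists2 a, a \in B & a \notin A.
  by apply/subsetPn/negP=> /subset_leq_card; rewrite dS dP.
have TS : (cspan e (B :\ a) <= S)%VS by rewrite SE (cspan_sub dimV fe) subsetDl.
have Tg : grass Om k (cspan e (B :\ a)).
  rewrite /grass (dim_cspan fe) (isotropicS TS isoS) andbT.
  by have := cardsD1 a B; rewrite dS aB add1n => -[->].
apply: subv_trans (sub _ _ Tg Sg TS); apply: hsub => //.
by rewrite PE (cspan_sub dimV fe) subsetD1 AB.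
Qed.

Lemma base_map0_frame h e : (0 < n)%N -> base_map Om Om' n 0 h -> frame Om e ->
  exists2 e', frame Om' e' & forall a, h <[e a]>%VS = <[e' a]>%VS.
Proof.
move=> n_gt0 hP fe; have [e' [phi ind]] := base_map_induces dimV' hP fe.
have [fe' hE phik phi_inj] := ind.
have k1 a : [set a] \in csts n 0.
  by apply/cstsP; rewrite cards1; split=> // b; rewrite !inE => /eqP->; rewrite sg_neq.
have [p pE] : {p & forall a, phi [set a] = [set p a]}.
  apply: (choice (P := fun a b => phi [set a] = [set b])) => a; apply/cards1P.
  by rewrite (card_csts (phik _ (k1 a))).
have p_inj : injective p.
  move=> a b E; have := phi_inj _ _ (k1 a) (k1 b).
  by rewrite !pE E => /(_ erefl)/set1_inj.
have p_sg a : p (sg a) = sg (p a).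
  have w : wadj 0 [set a] [set sg a].
    apply/andP; split; last by apply/exists_inP; exists a; rewrite inE.
    rewrite cards_eq0; apply/eqP/setP=> x; rewrite !inE.
    by apply/negP=> /andP[/eqP->]; rewrite eq_sym sg_neq.
  have := induces_wadj sympl dimV dimV' n_gt0 hP fe ind (k1 a) (k1 (sg a)) w.
  case/andP=> _ /exists_inP[x]; rewrite !pE !inE => /eqP-> /eqP.
  by [].
exists (e' \o p) => [a b|a]; first by rewrite /= fe' -p_sg (inj_eq p_inj).
by rewrite -cspan1 hE // pE cspan1.
Qed.

End Points.

From mathcomp Require Import classical_sets.

Local Open Scope classical_set_scope.

Section Points.
Variables (F : fieldType) (V : vectType F).
Implicit Types (U W S : {vspace V}) (p q : proj_point V) (X : set (proj_point V)).

Lemma vline_point (v : V) : v != 0 -> exists p : proj_point V, val p = <[v]>%VS.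
Proof.
move=> v0; have dv : \dim <[v]> == 1%N by rewrite dim_vline v0.
by exists (exist (fun U : {vspace V} => \dim U == 1%N) <[v]>%VS dv).
Qed.

Lemma dim1_vline U : \dim U = 1%N -> exists2 v, v != 0 & U = <[v]>%VS.
Proof.
move=> dU; have U0 : U != 0%VS by rewrite -dimv_eq0 dU.
exists (vpick U); first by rewrite vpick0.
by apply/esym/eqP; rewrite eqEdim -memvE memv_pick dim_vline vpick0 U0 dU.
Qed.

Lemma point_vline p : exists2 v, v != 0 & val p = <[v]>%VS.
Proof. by apply: dim1_vline; apply/eqP; apply: (valP p). Qed.

Lemma points_subset U W : points U `<=` points W -> (U <= W)%VS.
Proof.
move=> UW; apply/subvP=> v vU; have [->|v0] := eqVneq v 0; first exact: mem0v.
have [p pE] := vline_point v0; have := UW p; rewrite /points /= pE.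
by apply; rewrite -memvE.
Qed.

Lemma points_inj : injective (@points F V).
Proof.
by move=> U W UW; apply/eqP; rewrite eqEsubv !points_subset // UW.
Qed.

Lemma proj_spanE X W : X `<=` points W ->
  (forall U, X `<=` points U -> (W <= U)%VS) -> proj_span X = points W.
Proof.
move=> XW Wmin; apply/seteqP; split=> [p|p pW _ [[U _ <-] XU]].
  by apply; split=> //; exists W.
exact: subv_trans pW (Wmin U XU).
Qed.

Lemma dim2_vlines U : \dim U = 2%N -> exists u v,
  [/\ u != 0, v != 0, <[u]>%VS != <[v]>%VS & U = (<[u]> + <[v]>)%VS].
Proof.
move=> dU; have U0 : U != 0%VS by rewrite -dimv_eq0 dU.
have u0 : vpick U != 0 by rewrite vpick0.
have uU := memv_pick U; move: (vpick U) u0 uU => u u0 uU.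
have [v vU vu] : exists2 v, v \in U & v \notin <[u]>%VS.
  by apply/subvPn/negP=> /dimvS; rewrite dU dim_vline u0.
have v0 : v != 0 by apply: contraNneq vu => ->; rewrite mem0v.
exists u, v; split=> //.
  by apply: contraNneq vu => ->; rewrite memv_line.
apply/esym/eqP; rewrite eqEdim subv_add -!memvE uU vU dU /=.
rewrite dimv_disjoint_sum ?dim_vline ?u0 ?v0 //; apply/eqP; rewrite -subv0.
apply/subvP=> w; rewrite memv_cap => /andP[wu /vlineP[t wE]].
rewrite memv0; apply: contraNT vu; rewrite wE in wu *.
rewrite scaler_eq0 negb_or => /andP[t0 _].
by rewrite -(scalerK t0 v) memvZ.
Qed.

End Points.

Section SymplecticPoints.
Variables (F : fieldType) (V : vectType F) (Om : {skew_symmetric V}).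
Hypothesis sympl : is_psymplectic Om.
Variable n : nat.
Hypothesis dimV : \dim {:V} = (2 * n)%N.
Implicit Types (U W S : {vspace V}) (p q : proj_point V) (X : set (proj_point V)).
Implicit Types (a b c : lab n) (e d : lab n -> V).

Lemma perpP p q : perp Om p q <-> (val p <= orthov Om (val q))%VS.
Proof.
have [x x0 px] := point_vline p; have [y y0 qy] := point_vline q.
rewrite px qy orthov11; split=> [/(_ x y px qy)->//|xy u v pu qv].
by apply/eqP; rewrite -orthov11 -pu -qv px qy orthov11.
Qed.

Lemma totally_isotropicP S : totally_isotropic Om S <-> isotropic Om S.
Proof.
split=> [isoS|isoS p q pS qS].
  apply/orthovP=> u v uS vS.
  have [->|u0] := eqVneq u 0; first by rewrite linear0l.
  have [->|v0] := eqVneq v 0; first by rewrite linear0r.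
  have [[p pu] [q qv]] := (vline_point u0, vline_point v0).
  by apply: (isoS p q); rewrite /points /= ?pu ?qv // -memvE.
by apply/perpP; apply: isotropic_orthov isoS _ _.
Qed.

Lemma grassP k S : isotropic_grassmannian Om k S <-> grass Om k S.
Proof.
rewrite /isotropic_grassmannian /=; split=> [[dS /totally_isotropicP isoS]|].
  by rewrite /grass dS eqxx.
by case/andP=> /eqP dS /totally_isotropicP.
Qed.

Lemma grass_val k (S : isotropic_grassmannian Om k) : grass Om k (val S).
Proof. by apply/grassP; have := valP S; rewrite in_setE. Qed.

Lemma grass_sub k U : grass Om k U ->
  exists S : isotropic_grassmannian Om k, val S = U.
Proof.
move=> /grassP Ug; have Ug' : U \in isotropic_grassmannian Om k by rewrite in_setE.
by exists (exist _ U Ug').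
Qed.

Lemma grass_point p : grass Om 0 (val p).
Proof.
rewrite /grass (valP p) /=; have [v _ ->] := point_vline p.
by rewrite /isotropic orthov11 (formxx sympl).
Qed.

Definition frame_points e : set (proj_point V) :=
  [set p | exists a, val p = <[e a]>%VS].

Lemma symplectic_base_frame B : symplectic_base Om B ->
  exists2 e : lab n -> V, frame Om e & B = frame_points e.
Proof.
case=> x [p [xb pE uniq ->]].
have perpE i j : perp Om (p i) (p j) <-> Om (tnth x i) (tnth x j) = 0.
  by rewrite perpP !pE orthov11; split=> /eqP.
have [s sP] : {s & forall i, unique (fun j => ~ perp Om (p i) (p j)) (s i)}.
  apply: (choice (P := fun i => unique (fun j => ~ perp Om (p i) (p j)))) => i.
  exact: uniq.
have sK : involutive s.
  move=> i; have [_] := sP (s i); apply=> /perpE /formC0 /perpE.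
  by have [] := sP i.
have sn i : s i != i.
  apply/eqP=> si; have [] := sP i; rewrite si => + _; apply.
  by apply/perpE; rewrite formxx.
have [f f_bij fs] := involution_labels dimV sK sn.
exists (fun a => tnth x (f a)) => [a b|].
  apply/idP/eqP => [xab|->].
    apply: (bij_inj f_bij); rewrite fs; have [_ sE] := sP (f a).
    by apply/esym/sE => /perpE/eqP; rewrite (negPf xab).
  by rewrite fs; have [sE _] := sP (f a); apply/eqP => /perpE.
have [f' fK f'K] := f_bij.
apply/seteqP; split=> [_ [i _ <-]|q [a qa]].
  by exists (f' i); rewrite f'K pE.
by exists (f a) => //; apply: val_inj; rewrite pE qa.
Qed.

Lemma frame_symplectic_base e : frame Om e -> symplectic_base Om (frame_points e).
Proof.
move=> fe; have E : \dim {:V} = #|{: lab n}|.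
  by rewrite card_prod card_ord card_bool dimV mulnC.
pose l (i : 'I_(\dim {:V})) : lab n := enum_val (cast_ord E i).
pose l' a : 'I_(\dim {:V}) := cast_ord (esym E) (enum_rank a).
have lK : cancel l l' by move=> i; rewrite /l /l' enum_valK cast_ordK.
have l'K : cancel l' l by move=> a; rewrite /l /l' cast_ordKV enum_rankK.
have [p pE] : {p : lab n -> proj_point V & forall a, val (p a) = <[e a]>%VS}.
  apply: (choice (P := fun a (p : proj_point V) => val p = <[e a]>%VS)) => a.
  exact/vline_point/(frame_neq0 fe).
have perpE a b : perp Om (p a) (p b) <-> b != sg a.
  rewrite perpP !pE orthov11; split=> [ab|ab]; last by rewrite (frame0 fe).
  by rewrite -fe (eqP ab) eqxx.
exists [tuple e (l i) | i < \dim {:V}], (p \o l); split=> [|i|i|].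
- rewrite basisEdim size_tuple leqnn andbT.
  have [D DE] : exists D, cspan e D = fullv by eexists; apply: (cspanT dimV fe).
  apply: subv_trans (_ : (fullv <= cspan e D)%VS) _; first by rewrite DE.
  apply/subv_sumP=> a _; rewrite -memvE memv_span //.
  by apply/mapP; exists (l' a); rewrite ?mem_enum ?l'K.
- by rewrite tnth_mktuple /= pE.
- exists (l' (sg (l i))); split=> [/perpE|j /perpE]; rewrite /= ?l'K ?eqxx //.
  by move=> jl; apply: (can_inj lK); rewrite l'K; apply/esym/eqP; apply/negPn/negP.
apply/seteqP; split=> [q [a qa]|_ [i _ <-]]; last by exists (l i); rewrite /= pE.
by exists (l' a) => //; apply: val_inj; rewrite /= pE l'K qa.
Qed.

Definition frame_grass k e : set (isotropic_grassmannian Om k) :=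
  [set S | exists2 A, A \in csts n k & val S = cspan e A].

Lemma frame_grassE k e : frame Om e ->
  [set S : isotropic_grassmannian Om k |
    exists2 X, X `<=` frame_points e & points (val S) = proj_span X] =
  frame_grass (k := k) e.
Proof.
move=> fe.
have spanE X (D : {set lab n}) : X `<=` frame_points e ->
    (forall p a, X p -> val p = <[e a]>%VS -> a \in D) ->
    (forall a, a \in D -> exists2 p, X p & val p = <[e a]>%VS) ->
  proj_span X = points (cspan e D).
  move=> Xe XD DX; apply: proj_spanE => [p pX|U XU].
    have [a pa] := Xe p pX; rewrite /points /= pa (sumv_sup a) //.
    exact: XD pX pa.
  apply/subv_sumP=> a /DX[p /XU] /=.
  by rewrite /points /= => + <-.
apply/seteqP; split=> S.
  case=> X Xe SX.
  pose D : {set lab n} := finset (fun a => `[< exists2 p, X p & val p = <[e a]>%VS >]).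
  have DE : proj_span X = points (cspan e D).
    apply: spanE => // [p a pX pa|a]; first by rewrite inE; apply/asboolP; exists p.
    by rewrite inE => /asboolP.
  have SD : val S = cspan e D by apply: points_inj; rewrite SX DE.
  by exists D => //; rewrite -(grass_cspan k dimV D fe) -SD grass_val.
case=> A Ak SA; exists [set p | exists2 a, a \in A & val p = <[e a]>%VS].
  by move=> p [a _ pa]; exists a.
rewrite SA; apply/esym/spanE => [p [a _ pa]|p a [b bA pb] pa|a aA].
- by exists a.
- by rewrite -(frame_mem dimV fe) memvE -pa pb (sumv_sup b).
have [p pa] := vline_point (frame_neq0 fe a).
by exists p => //; exists a.
Qed.

Lemma base_subsetP k (A : set (isotropic_grassmannian Om k)) :
  base_subset A <-> exists2 e : lab n -> V, frame Om e & A = frame_grass (k := k) e.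
Proof.
split=> [[B /symplectic_base_frame[e fe ->] ->]|[e fe ->]].
  by exists e => //; apply: frame_grassE.
exists (frame_points e); first exact: frame_symplectic_base.
by rewrite frame_grassE.
Qed.

End SymplecticPoints.

Section PointMaps.
Variables (F F' : fieldType) (V : vectType F) (V' : vectType F').
Variables (Om : {skew_symmetric V}) (Om' : {skew_symmetric V'}).
Hypotheses (sympl : is_psymplectic Om) (sympl' : is_psymplectic Om').
Variable n : nat.
Hypotheses (dimV : \dim {:V} = (2 * n)%N) (dimV' : \dim {:V'} = (2 * n)%N).
Implicit Types (U W P Q : {vspace V}) (p q : proj_point V).
Implicit Types (a b c : lab n).

Lemma base_subset_map k
    (f : isotropic_grassmannian Om k -> isotropic_grassmannian Om' k) :
    (forall A, base_subset A -> base_subset (f @` A)) ->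
  exists2 g, base_map Om Om' n k g &
    forall S : isotropic_grassmannian Om k, g (val S) = val (f S).
Proof.
move=> hf; pose g U := if insub U is Some s then val (f s) else 0%VS.
have gE S : g (val S) = val (f S) by rewrite /g valK.
exists g => // e fe.
have /hf/(base_subsetP sympl' dimV')[e' fe' E] :
    base_subset (frame_grass (Om := Om) (k := k) e).
  by apply/(base_subsetP sympl dimV); exists e.
exists e'; split=> // [A Ak|B Bk].
  have [S SE] : exists S : isotropic_grassmannian Om k, val S = cspan e A.
    by apply: grass_sub; rewrite (grass_cspan k dimV A fe).
  have : (f @` frame_grass (k := k) e) (f S) by exists S => //; exists A.
  by rewrite E => -[B Bk fS]; exists B; rewrite // -SE gE.
have [S' SE'] : exists S : isotropic_grassmannian Om' k, val S = cspan e' B.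
  by apply: grass_sub; rewrite (grass_cspan k dimV' B fe').
have : frame_grass (k := k) e' S' by exists B.
rewrite -E => -[S [A Ak SE] fS].
by exists A; rewrite // -SE gE fS.
Qed.

Section OneMap.
Variable h : {vspace V} -> {vspace V'}.
Hypotheses (n_gt0 : (0 < n)%N) (hP : base_map Om Om' n 0 h).

Lemma point_frame P Q : grass Om 0 P -> grass Om 0 Q ->
  exists (e : lab n -> V) (e' : lab n -> V') a b, [/\ frame Om e, frame Om' e',
    P = <[e a]>%VS, Q = <[e b]>%VS & forall c, h <[e c]>%VS = <[e' c]>%VS].
Proof.
move=> Pg Qg; have [e [A [B [fe Ak Bk -> ->]]]] := grass_common_frame sympl dimV Pg Qg.
have /cards1P[a ->] : #|A| == 1%N by rewrite (card_csts Ak).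
have /cards1P[b ->] : #|B| == 1%N by rewrite (card_csts Bk).
have [e' fe' he] := base_map0_frame sympl dimV dimV' n_gt0 hP fe.
by exists e, e', a, b; rewrite !cspan1.
Qed.

Lemma base_map0_orthov P Q : grass Om 0 P -> grass Om 0 Q ->
  (h P <= orthov Om' (h Q))%VS = (P <= orthov Om Q)%VS.
Proof.
move=> Pg Qg; have [e [e' [a [b [fe fe' -> -> he]]]]] := point_frame Pg Qg.
by rewrite !he !orthov11 -[LHS]negbK -[RHS]negbK fe fe'.
Qed.

Let hdim P : grass Om 0 P -> \dim (h P) = 1%N.
Proof. by move=> /(base_map_grass sympl dimV dimV' hP)/andP[/eqP]. Qed.

Lemma base_map0_line U : \dim U = 2%N -> exists2 U', \dim U' = 2%N &
  forall P, grass Om 0 P -> (P <= U)%VS -> (h P <= U')%VS.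
Proof.
case/dim2_vlines=> u [v [u0 v0 uv ->]].
have vg w : w != 0 -> grass Om 0 <[w]>%VS.
  by move=> /vline_point[p <-]; apply: (grass_point sympl).
have [e [e' [a [b [fe fe' ua vb he]]]]] := point_frame (vg u u0) (vg v v0).
have ab : a != b by apply: contraNneq uv => ab; rewrite ua vb ab.
exists (cspan e' [set a; b]%SET); first by rewrite (dim_cspan fe') cards2 ab.
move=> P Pg PU; have [w w0 hw] : exists2 w, w != 0 & h P = <[w]>%VS.
  by apply/dim1_vline/hdim.
rewrite hw -memvE; apply/(cspanP dimV' fe') => c; rewrite !inE negb_or => /andP[ca cb].
apply/eqP; rewrite -orthov11 -he -hw base_map0_orthov //; last exact/vg/(frame_neq0 fe).
apply: subv_trans (_ : orthov Om (<[u]> + <[v]>) <= orthov Om P)%VS; last first.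
  by rewrite orthov_sym (subv_trans PU) // orthov_sym.
have ec0 x : c != x -> Om (e (sg c)) (e x) == 0.
  by move=> cx; rewrite (frame0 fe) // sgK eq_sym.
by rewrite orthovD ua vb !orthov11 !ec0.
Qed.

Lemma base_map0_embedding (hp : proj_point V -> proj_point V') :
  (forall p, val (hp p) = h (val p)) -> symplectic_embedding Om Om' hp.
Proof.
move=> hpE; have pg := grass_point sympl.
split; first split.
- move=> p q pq; apply: val_inj.
  by apply: (base_map_inj sympl dimV dimV' hP (pg p) (pg q)); rewrite -!hpE pq.
- move=> _ [U dU <-]; have [U' dU' UU'] := base_map0_line dU.
  exists (points U'); first by exists U'.
  by move=> _ [p pU <-]; rewrite /points /= hpE UU'.
- move=> _ _ _ [U' dU' <-] [U1 dU1 <-] [U2 dU2 <-] h1 h2.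
  have hin U p : hp @` points U `<=` points U' -> (val p <= U)%VS ->
      (h (val p) <= U')%VS.
    by move=> sub pU; rewrite -hpE; apply: sub; exists p.
  suff U21 : (U2 <= U1)%VS.
    by congr points; apply/esym/eqP; rewrite eqEdim U21 dU1 dU2.
  apply: contraT => /subvPn[z zU2 zU1].
  have [y [zy yU1]] := separate sympl zU1.
  have z0 : z != 0 by apply: contraNneq zU1 => ->; rewrite mem0v.
  have y0 : y != 0 by apply: contraNneq zy => ->; rewrite linear0r.
  have [u [v [u0 v0 uv U1E]]] := dim2_vlines dU1.
  have [[pu puE] [pv pvE]] := (vline_point u0, vline_point v0).
  have [[py pyE] [pz pzE]] := (vline_point y0, vline_point z0).
  have huv : h (val pu) != h (val pv).
    apply: contraNneq uv => /(base_map_inj sympl dimV dimV' hP (pg _) (pg _)).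
    by rewrite puE pvE => ->.
  have U'E : U' = (h (val pu) + h (val pv))%VS.
    apply: (add_hyperplanes (k := 1)) => //; [exact/hdim|exact/hdim| |  |].
    - by apply: hin h1 _; rewrite puE -memvE U1E (subvP (addvSl _ _)) ?memv_line.
    - by apply: hin h1 _; rewrite pvE -memvE U1E (subvP (addvSr _ _)) ?memv_line.
    apply: contraNN huv => le; rewrite eqEdim le.
    by rewrite !(hdim (pg _)).
  have : (h (val pz) <= orthov Om' (h (val py)))%VS.
    have zU' : (h (val pz) <= U')%VS by apply: hin h2 _; rewrite pzE -memvE.
    apply: subv_trans zU' _; rewrite U'E subv_add !base_map0_orthov //.
    rewrite puE pvE pyE !orthov11 -!(herm_eq0C Om y) !yU1 ?eqxx // U1E.
      by apply: subvP (addvSr _ _) _ (memv_line v).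
    by apply: subvP (addvSl _ _) _ (memv_line u).
  by rewrite base_map0_orthov // pyE pzE orthov11 (negPf zy).
move=> B /(symplectic_base_frame sympl dimV)[e fe ->].
have [e' fe' he] := base_map0_frame sympl dimV dimV' n_gt0 hP fe.
have -> : hp @` frame_points e = frame_points e'.
  apply/seteqP; split=> [_ [p [a pa] <-]|q [a qa]].
    by exists a; rewrite hpE pa he.
  have [p pa] := vline_point (frame_neq0 fe a).
  by exists p; [exists a|apply: val_inj; rewrite hpE pa he qa].
exact: frame_symplectic_base.
Qed.

End OneMap.
End PointMaps.

Theorem theorem1 (n k : nat) (hn : (1 <= n)%N) (hk : (k < n)%N)
    (F F' : fieldType) (V : vectType F) (V' : vectType F')
    (dimV : \dim {:V} = (2 * n)%N) (dimV' : \dim {:V'} = (2 * n)%N)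
    (Omega : {skew_symmetric V}) (Omega' : {skew_symmetric V'})
    (sympl : is_psymplectic Omega) (sympl' : is_psymplectic Omega')
    (f : isotropic_grassmannian Omega k -> isotropic_grassmannian Omega' k)
    (hf : forall A : set (isotropic_grassmannian Omega k),
        base_subset A -> base_subset (f @` A)) :
  exists h : proj_point V -> proj_point V',
    symplectic_embedding Omega Omega' h /\
    forall S : isotropic_grassmannian Omega k,
      points (val (f S)) = proj_span (h @` points (val S)).
Proof.
have [g gP gE] := base_subset_map sympl sympl' dimV dimV' hf.
have [h hP hg] := base_map_points sympl dimV dimV' hk gP.
have pg := grass_point sympl.
have hdim (p : proj_point V) : \dim (h (val p)) == 1%N.
  by have /andP[] := base_map_grass sympl dimV dimV' hP (pg p).
pose hp (p : proj_point V) : proj_point V' :=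
  exist (fun U : {vspace V'} => \dim U == 1%N) _ (hdim p).
have hpE (p : proj_point V) : val (hp p) = h (val p) by [].
exists hp; split; first exact: base_map0_embedding hn hP _ hpE.
move=> S; have Sg := grass_val S; have gSg := grass_val (f S).
have hpS : hp @` points (val S) `<=` points (val (f S)).
  by move=> _ [p pS <-]; rewrite -gE; apply: hg Sg (pg p) pS.
apply/esym/proj_spanE => // U hU.
have [e [A [_ [fe Ak _ SE _]]]] := grass_common_frame sympl dimV Sg Sg.
have [e' fe' he] := base_map0_frame sympl dimV dimV' hn hP fe.
have leU W : hp @` points (val S) `<=` points W -> (cspan e' A <= W)%VS.
  move=> SW; apply/subv_sumP=> a aA; have [p pa] := vline_point (frame_neq0 fe a).
  rewrite -he -pa -hpE; apply: SW; exists p => //.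
  by rewrite /points /= pa SE (sumv_sup a).
have -> : val (f S) = cspan e' A.
  apply/esym/eqP; rewrite eqEdim (dim_cspan fe') (card_csts Ak).
  have /andP[/eqP-> _] := gSg; rewrite leqnn andbT; exact: leU.
exact: leU.
Qed.
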